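(* Let $X:\Sigma\to\mathbb{I}^3$ be a non-planar zero mean curvature immersion conformally parametrized by $(u,v)\in\Sigma$ so that $ds^2=e^{2\omega}(du^2+dv^2)$, with normalized Hopf differential $Q\,dz^2=-\tfrac12\,dz^2$ ($z=u+iv$). Then $X$ has planar curvature lines if and only if, up to a change of coordinates composed of translations $(u,v)\mapsto(u+u_0,v+v_0)$, sign changes $u\mapsto-u$, $v\mapsto-v$, and the interchange $(u,v)\mapsto(v,u)$, the function $\omega$ is one of the following, where $f:=\omega_ue^{\omega}$ and $g:=\omega_ve^{\omega}$: Case (1): $\omega$ is not constant, and one of: (1a) for some $\alpha>0$ (and $\beta=0$): $f=-e^{-\alpha u}$, $g=0$, so that $e^{\omega}=\frac1\alpha e^{-\alpha u}$; in this case $X$ is a surface of revolution. (1b) for some $\beta>0$ (and $\alpha=0$): $f=\beta u$, $g=\beta v$, so that $e^{\omega}=\frac\beta2(u^2+v^2)$; this is non-periodic in both the $u$-direction and the $v$-direction. (1c) for some $\alpha>0$ and $\beta>0$: $f=\frac\beta\alpha\sinh\alpha u$, $g=\frac\beta\alpha\sin\alpha v$, so that $e^{\omega}=\frac{\beta}{\alpha^2}(\cosh\alpha u-\cos\alpha v)$; this is non-periodic in the $u$-direction but periodic in the $v$-direction. Case (2): $\omega\equiv c$ for some $c\in\mathbb{R}$.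
   Context: Isotropic space: $\mathbb{R}^{3,1}$ is Minkowski $4$-space with bilinear form $\langle\cdot,\cdot\rangle$ of signature $(-+++)$, $\mathcal{L}=\{Y:\langle Y,Y\rangle=0\}$, $\mathfrak{p}=(1,0,0,1)^t\in\mathcal{L}$, and $\mathbb{I}^3=\{Y\in\mathbb{R}^{3,1}:\langle Y,\mathfrak{p}\rangle=0\}=\{(\mathbf l,\mathbf x,\mathbf y,\mathbf l)^t\}$, with degenerate induced metric $d\mathbf x^2+d\mathbf y^2$; it is identified with coordinate space $\{(\mathbf l,\mathbf x,\mathbf y)\}$. Isometries of $\mathbb{I}^3$ are compositions of translations of $\mathbb{I}^3$ and the restrictions to $\mathbb{I}^3$ of $A\in\mathrm{SO}(3,1)$ with $A\mathfrak p=\mathfrak p$. Surfaces: $\Sigma$ is a simply-connected domain and $X:\Sigma\to\mathbb{I}^3$ is a spacelike immersion (the induced metric is Riemannian), with conformal coordinates $z=u+iv$ and $ds^2=e^{2\omega}(du^2+dv^2)$, $\omega$ real-valued. The lightlike Gauss map $n:\Sigma\to\mathcal L$ is the unique map with $\langle dX,n\rangle=0$, $\langle n,\mathfrak p\rangle=1$. Put $L=\langle X_{uu},n\rangle$, $M=\langle X_{uv},n\rangle$, $N=\langle X_{vv},n\rangle$. The mean curvature is $H=\tfrac12e^{-2\omega}(L+N)$ and the Hopf differential is $Q\,dz^2=\tfrac14(L-N-2iM)\,dz^2$; zero mean curvature means $H\equiv0$. When $Q=-\tfrac12$, the coordinate lines $u\mapsto X(u,v)$ and $v\mapsto X(u,v)$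 are the curvature lines. Planar curvature lines: every curvature line lies in an affine plane of $\mathbb{I}^3$. Periodicity in (1b), (1c) refers to the conformal factor $e^\omega$. A surface of revolution is (up to an isometry of $\mathbb{I}^3$) a surface (locally) invariant under the rotations $(\mathbf l,\mathbf x,\mathbf y)\mapsto(\mathbf l,\ \mathbf x\cos t-\mathbf y\sin t,\ \mathbf x\sin t+\mathbf y\cos t)$. *)

(* Defs.v *)
From HB Require Import structures.
From mathcomp Require Import all_boot all_order all_algebra.
From mathcomp Require Import all_classical all_reals all_analysis.
From mathcomp Require Import complex.
Set Implicit Arguments.
Unset Strict Implicit.
Unset Printing Implicit Defensive.
Import Order.TTheory GRing.Theory Num.Theory.
Import numFieldNormedType.Exports.
Local Open Scope classical_set_scope.
Local Open Scope ring_scope.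

Section Isotropic.
Variable R : realType.

Definition vec4 (a b c d : R) : 'cV[R]_4 := \col_i [:: a; b; c; d]`_i.

(* Indices 0, 1, 2, 3 of R^{3,1}; index 0 is the timelike one. *)
Definition mink (Y Z : 'cV[R]_4) : R :=
  - (Y 0 0 * Z 0 0) + \sum_(i < 4 | i != 0) Y i 0 * Z i 0.

Definition light_cone : set 'cV[R]_4 := [set Y | mink Y Y = 0].

Definition pp : 'cV[R]_4 := vec4 1 0 0 1.

Definition I3 : set 'cV[R]_4 := [set Y | mink Y pp = 0].

Definition SO31 (A : 'M[R]_4) : Prop :=
  (forall Y Z, mink (A *m Y) (A *m Z) = mink Y Z) /\ \det A = 1.

(* The maps Y |-> A Y + b are closed under composition: A fixes pp and
   preserves the form, so A maps I3 to I3. *)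
Definition isometry_I3 (T : 'cV[R]_4 -> 'cV[R]_4) : Prop :=
  exists (A : 'M[R]_4) (b : 'cV[R]_4),
    [/\ SO31 A, A *m pp = pp, I3 b & forall Y, T Y = A *m Y + b].

Definition affine_plane (P : set 'cV[R]_4) : Prop :=
  exists (Y0 : 'cV[R]_4) (W : 'M[R]_(4, 2)),
    [/\ I3 Y0, \rank W = 2%N, forall c : 'cV[R]_2, I3 (W *m c) &
        P = [set Y0 + W *m c | c in [set: 'cV[R]_2]]].

(* In the coordinates (l, x, y) of (l, x, y, l). *)
Definition rotation (t : R) (Y : 'cV[R]_4) : 'cV[R]_4 :=
  let l := Y 0 0 in let x := Y 1 0 in let y := Y 2%:R 0 in
  vec4 l (x * cos t - y * sin t) (x * sin t + y * cos t) l.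

Definition simply_connected (D : set (R * R)) : Prop :=
  forall gamma : R -> R * R,
    {within `[0, 1], continuous gamma} ->
    (forall t, t \in `[0, 1] -> D (gamma t)) -> gamma 0 = gamma 1 ->
    exists F : R * R -> R * R,
      [/\ {within `[0, 1] `*` `[0, 1], continuous F},
          forall s t, s \in `[0, 1] -> t \in `[0, 1] -> D (F (s, t)),
          forall t, t \in `[0, 1] -> F (0, t) = gamma t,
          forall t, t \in `[0, 1] -> F (1, t) = gamma 0 &
          forall s, s \in `[0, 1] -> F (s, 0) = gamma 0 /\ F (s, 1) = gamma 0].

Definition simply_connected_domain (D : set (R * R)) : Prop :=
  [/\ D !=set0, open D, connected D & simply_connected D].

Definition eu : R * R := (1, 0).
Definition ev : R * R := (0, 1).

(* C^oo on an open set D: every iterated directional derivative is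
   differentiable at every point of D. *)
Definition smooth_on (V : normedModType R) (D : set (R * R))
    (F : R * R -> V) : Prop :=
  forall (s : seq (R * R)) p, D p ->
    differentiable (foldr (fun w (G : R * R -> V) => 'D_w G) F s) p.

Section Surface.
Variables (Sigma : set (R * R)) (X n : R * R -> 'cV[R]_4) (w : R * R -> R).

Definition spacelike_immersion : Prop :=
  [/\ smooth_on Sigma X, forall p, Sigma p -> I3 (X p),
      forall p, Sigma p -> injective ('d X p) &
      forall p h, Sigma p -> h != 0 -> 0 < mink ('d X p h) ('d X p h)].

Definition conformal_factor : Prop :=
  forall p, Sigma p ->
    [/\ mink ('D_eu X p) ('D_eu X p) = expR (2 * w p),
        mink ('D_ev X p) ('D_ev X p) = expR (2 * w p) &
        mink ('D_eu X p) ('D_ev X p) = 0].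

Definition lightlike_gauss_map : Prop :=
  forall p, Sigma p ->
    [/\ light_cone (n p), forall h, mink ('d X p h) (n p) = 0 &
        mink (n p) pp = 1].

Definition sff_L (p : R * R) : R := mink ('D_eu ('D_eu X) p) (n p).
Definition sff_M (p : R * R) : R := mink ('D_ev ('D_eu X) p) (n p).
Definition sff_N (p : R * R) : R := mink ('D_ev ('D_ev X) p) (n p).

Definition mean_curvature (p : R * R) : R :=
  2^-1 * expR (- (2 * w p)) * (sff_L p + sff_N p).

Definition hopf (p : R * R) : R[i] :=
  (4^-1 * ((sff_L p - sff_N p)%:C - 2 * Complex 0 1 * (sff_M p)%:C))%C.

(* Curvature lines through p in the case Q = -1/2. Sigma need not be convex, so a
   coordinate line may meet Sigma in several pieces; each piece is a curve. *)
Definition u_line (p : R * R) : set 'cV[R]_4 :=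
  [set X (u, p.2) | u in connected_component [set u | Sigma (u, p.2)] p.1].
Definition v_line (p : R * R) : set 'cV[R]_4 :=
  [set X (p.1, v) | v in connected_component [set v | Sigma (p.1, v)] p.2].

Definition planar_curvature_lines : Prop :=
  forall p, Sigma p ->
    (exists2 P, affine_plane P & u_line p `<=` P) /\
    (exists2 P, affine_plane P & v_line p `<=` P).

Definition planar_surface : Prop :=
  exists2 P, affine_plane P & X @` Sigma `<=` P.

End Surface.

(* Local invariance under the flow: points near p are moved, for small t, to
   points of the piece of surface parametrized by any given neighbourhood of p. *)
Definition locally_rotation_invariant (Sigma : set (R * R))
    (Y : R * R -> 'cV[R]_4) : Prop :=
  forall p U, Sigma p -> nbhs p U ->
    \forall q \near p & t \near (0 : R),
      exists2 q', (U `&` Sigma) q' & rotation t (Y q) = Y q'.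

Definition surface_of_revolution (Sigma : set (R * R))
    (X : R * R -> 'cV[R]_4) : Prop :=
  exists2 T, isometry_I3 T & locally_rotation_invariant Sigma (T \o X).

(* phi expresses the old coordinates in terms of the new ones, so that a
   function w on Sigma becomes w \o phi on phi @^-1` Sigma. *)
Inductive coord_change : (R * R -> R * R) -> Prop :=
| coord_id : coord_change id
| coord_trans u0 v0 phi : coord_change phi ->
    coord_change (fun p => phi (p.1 + u0, p.2 + v0))
| coord_sign_u phi : coord_change phi ->
    coord_change (fun p => phi (- p.1, p.2))
| coord_sign_v phi : coord_change phi ->
    coord_change (fun p => phi (p.1, - p.2))
| coord_swap phi : coord_change phi ->
    coord_change (fun p => phi (p.2, p.1)).

Definition cosh (x : R) : R := (expR x + expR (- x)) / 2.
Definition sinh (x : R) : R := (expR x - expR (- x)) / 2.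

Definition f_of (w : R * R -> R) (p : R * R) : R := 'D_eu w p * expR (w p).
Definition g_of (w : R * R -> R) (p : R * R) : R := 'D_ev w p * expR (w p).

Section Cases.
Variables (D : set (R * R)) (w : R * R -> R).

Definition constant_on : Prop := exists c : R, forall p, D p -> w p = c.

Definition case1a (a : R) : Prop :=
  forall p, D p -> f_of w p = - expR (- (a * p.1)) /\ g_of w p = 0.

Definition case1b (b : R) : Prop :=
  forall p, D p -> f_of w p = b * p.1 /\ g_of w p = b * p.2.

Definition case1c (a b : R) : Prop :=
  forall p, D p -> f_of w p = b / a * sinh (a * p.1) /\
                   g_of w p = b / a * sin (a * p.2).

Definition case1 : Prop :=
  ~ constant_on /\
  [\/ exists2 a, 0 < a & case1a a,
      exists2 b, 0 < b & case1b b |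
      exists a b, [/\ 0 < a, 0 < b & case1c a b]].

Definition case2 : Prop := constant_on.

End Cases.

(* The closed forms of e^w, as functions on the whole plane: since D may be too
   small for a period to fit, periodicity is a property of these formulas. *)
Definition exp_w1a (a : R) (p : R * R) : R := a^-1 * expR (- (a * p.1)).
Definition exp_w1b (b : R) (p : R * R) : R := b / 2 * (p.1 ^+ 2 + p.2 ^+ 2).
Definition exp_w1c (a b : R) (p : R * R) : R :=
  b / a ^+ 2 * (cosh (a * p.1) - cos (a * p.2)).

Definition periodic_along (e : R * R) (E : R * R -> R) : Prop :=
  exists2 T : R, 0 < T & periodic E (T *: e).

End Isotropic.

(* Main.v *)
Require Import Defs.
From HB Require Import structures.
From mathcomp Require Import all_boot all_order all_algebra.
From mathcomp Require Import all_classical all_reals all_analysis.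
From mathcomp Require Import complex.
From mathcomp Require Import ring lra.
Set Implicit Arguments.
Unset Strict Implicit.
Unset Printing Implicit Defensive.
Import Order.TTheory GRing.Theory Num.Theory.
Import numFieldNormedType.Exports.
Local Open Scope classical_set_scope.
Local Open Scope ring_scope.

(* Put E = e^omega, f = E_u and g = E_v.  With Q = -1/2 and H = 0 the Gauss-Weingarten
   equations read
     E X_uu = f X_u - g X_v - E p,  E X_uv = g X_u + f X_v,  E X_vv = - f X_u + g X_v + E p,
   and their integrability condition is E (f_u + g_v) = f^2 + g^2, i.e. omega is harmonic.
   X_uuu is congruent to a multiple of E_uv X_v modulo X_u and X_uu, so the u-lines are
   planar iff E_uv = 0, and by symmetry so are the v-lines.  If E_uv = 0, then
   K = (f_u - g_v) / E has zero gradient, f_uu = K f and g_vv = - K g.  After interchanging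
   u and v we may take K = alpha^2 >= 0; solving these linear equations, with
   f_u^2 - K f^2 = g_v^2 + K g^2 and E > 0 fixing the constants, gives the list of cases.
   In case (1a) the frame equations integrate to
     X = C - (u / alpha) p - e^(- alpha u) (cos (alpha v) A - sin (alpha v) B) / alpha,
   with constant vectors A, B, C; a translation and a null rotation fixing p remove C and
   the l-components of A and B. *)

(** The domain need not be convex, so a function with zero v-derivative is locally, but not always
    globally, a function of u. Hence no differential equation is solved along coordinate lines:
    integration is replaced by first integrals, explicit expressions with zero gradient, which are
    constant on a connected open set by [partials0_const]. The constants of the classification and
    those of case (1a) arise in this way. Regularity is given for X only, so E, f and g are obtained
    from X, and the differentiability of omega follows from that of E. Working with E rather than
    omega also keeps the equations rational, within reach of [ring] and [field]. Planarity is tested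
    with a covector constant along the curve, the dual form of the statement on X_uuu; this treats
    the points where g vanishes like all others. For the converse the cases are given in new
    coordinates while planarity is asked in the old ones. This is why the whole frame, with its sign
    c, is transported along changes of coordinates. *)

Lemma subr0P (V : zmodType) (a b z : V) : a - b = z -> z = 0 -> a = b.
Proof. by move=> <- /eqP; rewrite subr_eq0 => /eqP. Qed.

(** Proof by certificate: [z] is a combination of differences of known equations, [ring] checks that
    it is the difference of the two sides of the goal, and [z = 0] remains. *)
Ltac lincomb z := apply: (@subr0P _ _ _ z); first ring.

(** * Partial derivatives in the plane *)

Section PlaneCalculus.
Variable R : realType.
Implicit Types (V : normedModType R).

(** As [phi] is affine along [v], both difference quotients are the same function of h; a mere
    directional derivative transfers. *)
Lemma is_derive_reparam V1 V2 V3 (F : V2 -> V3) (phi : V1 -> V2) a v w d :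
  (forall h : R, phi (h *: v + a) = h *: w + phi a) ->
  is_derive (phi a) w F d -> is_derive a v (F \o phi) d.
Proof.
move=> phiE [dF <-].
have E : (fun h : R => h^-1 *: ((F \o phi \o shift a) (h *: v) - (F \o phi) a)) =
         (fun h : R => h^-1 *: ((F \o shift (phi a)) (h *: w) - F (phi a))).
  by apply/funext => h /=; rewrite phiE.
by split; [rewrite /derivable E | rewrite /derive E].
Qed.

Lemma is_derive_uniq V1 V2 (F : V1 -> V2) a v d1 d2 :
  is_derive a v F d1 -> is_derive a v F d2 -> d1 = d2.
Proof. by move=> [_ <-] [_ <-]. Qed.

Section Rules.
Variables (V : normedModType R) (p v : V).
Implicit Types F G : V -> R.

Lemma derv_cst (c : R) : is_derive p v (fun=> c) 0.
Proof. exact: is_derive_cst. Qed.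

Lemma derv_opp F a : is_derive p v F a -> is_derive p v (fun q => - F q) (- a).
Proof. exact: is_deriveN. Qed.

Lemma derv_add F G a b : is_derive p v F a -> is_derive p v G b ->
  is_derive p v (fun q => F q + G q) (a + b).
Proof. exact: is_deriveD. Qed.

Lemma derv_mul F G a b : is_derive p v F a -> is_derive p v G b ->
  is_derive p v (fun q => F q * G q) (a * G p + F p * b).
Proof.
move=> dF dG; apply: (is_derive_eq (is_deriveM dF dG)).
by rewrite /GRing.scale /= addrC mulrC.
Qed.

Lemma derv_inv F a : F p != 0 -> is_derive p v F a ->
  is_derive p v (fun q => (F q)^-1) (- (a / F p ^+ 2)).
Proof.
move=> F0 [dF <-].
split; first exact: derivableV.
by rewrite deriveV// /GRing.scale /= mulNr mulrC.
Qed.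

(** Restriction to a line makes the one-variable chain rule available for directional
    derivatives. *)
Lemma is_derive_line V2 (F : V -> V2) d :
  is_derive p v F d <-> is_derive (0 : R) 1 (fun s => F (s *: v + p)) d.
Proof.
have E : (fun k : R => k^-1 *: ((F \o shift p) (k *: v) - F p)) =
  (fun k : R => k^-1 *: (((fun s => F (s *: v + p)) \o shift 0) (k *: 1)
    - F ((0 : R) *: v + p))).
  by apply/funext => k /=; rewrite scale0r add0r addr0 [k *: 1]/GRing.scale /= mulr1.
by split=> -[dF <-]; split; move: dF; rewrite /derivable /derive E.
Qed.

Lemma derv_comp (h : R -> R) F a b : is_derive (F p) 1 h b ->
  is_derive p v F a -> is_derive p v (fun q => h (F q)) (b * a).
Proof.
move=> dh /is_derive_line dF; apply/is_derive_line.
by apply: is_derive1_comp => //; rewrite scale0r add0r.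
Qed.

Lemma derv_exp F a : is_derive p v F a ->
  is_derive p v (fun q => expR (F q)) (expR (F p) * a).
Proof. by move=> dF; apply: derv_comp. Qed.

Lemma derv_cos F a : is_derive p v F a ->
  is_derive p v (fun q => cos (F q)) (- sin (F p) * a).
Proof. by move=> dF; apply: derv_comp. Qed.

Lemma derv_sin F a : is_derive p v F a ->
  is_derive p v (fun q => sin (F q)) (cos (F p) * a).
Proof. by move=> dF; apply: derv_comp. Qed.

End Rules.

Lemma derv_fst p v : is_derive p v (fun q : R * R => q.1) v.1.
Proof.
have H := @is_derive_reparam _ _ _ id (fun q : R * R => q.1) p v v.1 v.1.
exact: H.
Qed.

Lemma derv_snd p v : is_derive p v (fun q : R * R => q.2) v.2.
Proof.
have H := @is_derive_reparam _ _ _ id (fun q : R * R => q.2) p v v.2 v.2.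
exact: H.
Qed.

Lemma eu1 : (eu R).1 = 1. Proof. by []. Qed.
Lemma eu2 : (eu R).2 = 0. Proof. by []. Qed.
Lemma ev1 : (ev R).1 = 0. Proof. by []. Qed.
Lemma ev2 : (ev R).2 = 1. Proof. by []. Qed.
Definition dirE := (eu1, eu2, ev1, ev2).

Lemma zero_derive_eq (h : R -> R) (a b : R) :
  (forall x, (a <= x <= b) || (b <= x <= a) -> is_derive x 1 h 0) ->
  h a = h b.
Proof.
wlog ab : a b / a <= b => [H|] dh.
  have /orP[ab|ba] := le_total a b; first exact: (H a b ab dh).
  by apply/esym/(H b a ba) => x; rewrite orbC; exact: dh.
have [||c _] := @MVT_segment R h (fun=> 0) a b ab.
- by move=> x; rewrite in_itv /= => /andP[ax xb]; apply: dh; rewrite (ltW ax) (ltW xb).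
- apply: derivable_within_continuous => x; rewrite in_itv /= => xab.
  by apply: ex_derive; apply: dh; rewrite xab.
- by rewrite mul0r => /eqP; rewrite subr_eq0 => /eqP.
Qed.

Lemma is_derive_fst (F : R * R -> R) u v d :
  is_derive (u, v) (eu R) F d -> is_derive u 1 (fun s => F (s, v)) d.
Proof.
move=> dF; apply: (@is_derive_reparam _ _ _ F (fun s => (s, v)) u 1 (eu R)) => //.
by move=> h; rewrite /eu; congr pair => /=; rewrite /GRing.scale /= mulr0 add0r.
Qed.

Lemma is_derive_snd (F : R * R -> R) u v d :
  is_derive (u, v) (ev R) F d -> is_derive v 1 (fun s => F (u, s)) d.
Proof.
move=> dF; apply: (@is_derive_reparam _ _ _ F (fun s => (u, s)) v 1 (ev R)) => //.
by move=> h; rewrite /ev; congr pair => /=; rewrite /GRing.scale /= mulr0 add0r.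
Qed.

Lemma derv_oppdir (F : R * R -> R) p v d :
  is_derive p v F d -> is_derive p (- v) F (- d).
Proof.
move=> dF; apply/is_derive_line.
have -> : (fun s : R => F (s *: - v + p)) = (fun s => F (s *: v + p)) \o -%R.
  by apply/funext => s /=; rewrite scalerN scaleNr.
rewrite -mulrN1; apply: is_derive1_comp; rewrite oppr0.
exact: (is_derive_line _ _ _ _).1.
Qed.

Definition partials (D : set (R * R)) (F Fu Fv : R * R -> R) : Prop :=
  forall p, D p -> is_derive p (eu R) F (Fu p) /\ is_derive p (ev R) F (Fv p).

(* A box: sup-norm balls of R * R are products of intervals. *)
Lemma nbhs_box (p : R * R) (U : set (R * R)) : nbhs p U ->
  exists2 e : R, 0 < e &
    forall u v, `|u - p.1| < e -> `|v - p.2| < e -> U (u, v).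
Proof.
move=> /nbhs_ballP [e /= e0 He]; exists e => // u v hu hv.
by apply: He; split => /=; rewrite /ball /= distrC.
Qed.

Lemma dist_between (a b c x e : R) : `|a - c| < e -> `|b - c| < e ->
  (a <= x <= b) || (b <= x <= a) -> `|x - c| < e.
Proof.
rewrite !ltr_norml => /andP[a1 a2] /andP[b1 b2].
by move=> /orP[] /andP[x1 x2]; apply/andP; split; lra.
Qed.

Lemma const_fst (F : R * R -> R) (p : R * R) (e : R) :
  (forall u v, `|u - p.1| < e -> `|v - p.2| < e ->
     is_derive (u, v) (eu R) F 0) ->
  forall u u' v, `|u - p.1| < e -> `|u' - p.1| < e -> `|v - p.2| < e ->
  F (u, v) = F (u', v).
Proof.
move=> dF u u' v hu hu' hv.
apply: (@zero_derive_eq (fun s => F (s, v))) => x hx.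
by apply: is_derive_fst; apply: dF => //; apply: dist_between hx.
Qed.

Lemma const_snd (F : R * R -> R) (p : R * R) (e : R) :
  (forall u v, `|u - p.1| < e -> `|v - p.2| < e ->
     is_derive (u, v) (ev R) F 0) ->
  forall u v v', `|u - p.1| < e -> `|v - p.2| < e -> `|v' - p.2| < e ->
  F (u, v) = F (u, v').
Proof.
move=> dF u v v' hu hv hv'.
apply: (@zero_derive_eq (fun s => F (u, s))) => x hx.
by apply: is_derive_snd; apply: dF => //; apply: dist_between hx.
Qed.

(** In a box each point is joined to [p] by a horizontal and a vertical segment. *)
Lemma partials0_locally_const D F p : open D -> D p ->
  partials D F (fun=> 0) (fun=> 0) -> \forall q \near p, F q = F p.
Proof.
move=> oD Dp dF; have /nbhs_box [e e0 He] := open_nbhs_nbhs (conj oD Dp).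
apply/nbhs_ballP; exists e => //= -[u v] [/= hu hv].
rewrite /ball /= distrC in hu; rewrite /ball /= distrC in hv.
have z1 : `|p.1 - p.1| < e by rewrite subrr normr0.
have z2 : `|p.2 - p.2| < e by rewrite subrr normr0.
rewrite (@const_fst F p e _ u p.1 v) //; last first.
  by move=> ? ? a b; exact: (dF _ (He _ _ a b)).1.
rewrite (@const_snd F p e _ p.1 v p.2) //; first by rewrite -surjective_pairing.
by move=> ? ? a b; exact: (dF _ (He _ _ a b)).2.
Qed.

(** Local constancy makes the level set of [F p] and its complement in [D] both open. *)
Lemma partials0_const D F : open D -> connected D ->
  partials D F (fun=> 0) (fun=> 0) -> forall p q, D p -> D q -> F q = F p.
Proof.
move=> oD cD dF p q Dp Dq.
have loc x : D x -> \forall q \near x, D q /\ F q = F x.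
  move=> Dx; have := partials0_locally_const oD Dx dF.
  have : \forall q \near x, D q by exact: open_nbhs_nbhs.
  by apply: filterS2.
pose A := D `&` [set x | F x = F p].
have A0 : A !=set0 by exists p.
suff AD : A = D by have [] : A q by rewrite AD.
apply: cD => //.
- exists A; last by rewrite setIA setIid.
  rewrite openE => x [Dx Fx]; have := loc _ Dx.
  by apply: filterS => y [Dy Fy]; split=> //=; rewrite Fy.
- exists (~` (D `&` [set x | F x != F p])).
    apply: open_closedC; rewrite openE => x [Dx Fx]; have := loc _ Dx.
    by apply: filterS => y [Dy Fy]; split=> //=; rewrite Fy.
  apply/seteqP; split=> x [Dx Fx]; split=> //=.
    by move=> [_ /eqP].
  by apply/eqP/negPn/negP => h; apply: Fx.
Qed.

(** On a box [F] is a function of v alone, hence so is its v-derivative. The existence of the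
    u-derivative of [Fv] is part of the conclusion, which later allows second derivatives of E to be
    differentiated again. *)
Lemma partials_indep_fst D (F Fv : R * R -> R) : open D ->
  (forall p, D p -> is_derive p (eu R) F 0) ->
  (forall p, D p -> is_derive p (ev R) F (Fv p)) ->
  forall p, D p -> is_derive p (eu R) Fv 0.
Proof.
move=> oD dFu dFv p Dp.
have /nbhs_box [e e0 He] := open_nbhs_nbhs (conj oD Dp).
have z1 : `|p.1 - p.1| < e by rewrite subrr normr0.
have key u v : `|u - p.1| < e -> `|v - p.2| < e -> Fv (u, v) = Fv (p.1, v).
  move=> hu hv; apply: (@is_derive_uniq _ _ (fun s => F (u, s)) v 1).
    by apply: is_derive_snd; apply: dFv; exact: He.
  have : is_derive v 1 (fun s => F (p.1, s)) (Fv (p.1, v)).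
    by apply: is_derive_snd; apply: dFv; exact: He.
  apply: near_eq_is_derive; apply/nbhs_ballP; exists (e - `|v - p.2|) => /=.
    by rewrite subr_gt0.
  move=> s hs; apply: (@const_fst F p e) => //; first by move=> ? ? a b; apply/dFu/He.
  have -> : s - p.2 = (s - v) + (v - p.2) by rewrite addrA subrK.
  by rewrite (le_lt_trans (ler_normD _ _)) // -ltrBrDr distrC.
have : is_derive p (eu R) (fun q => Fv (p.1, q.2)) (0 : R).
  apply: (@is_derive_reparam _ _ _ (fun s : R => Fv (p.1, s))
            (fun q : R * R => q.2) p (eu R) 0); last exact: is_derive0.
  by move=> h; rewrite /= !scaler0.
apply: near_eq_is_derive; apply/nbhs_ballP; exists e => //= -[u v] [/= hu hv].
rewrite /ball /= distrC in hu; rewrite /ball /= distrC in hv.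
by rewrite (key u v).
Qed.

(* The mean value theorem applied twice to the second difference over a square. *)
Lemma second_difference (F Fu Fuv : R * R -> R) (p : R * R) (e h : R) :
  (forall u v, `|u - p.1| < e -> `|v - p.2| < e ->
     is_derive (u, v) (eu R) F (Fu (u, v)) /\
     is_derive (u, v) (ev R) Fu (Fuv (u, v))) ->
  0 < h < e ->
  exists q, [/\ `|q.1 - p.1| < h, `|q.2 - p.2| < h &
    F (p.1 + h, p.2 + h) - F (p.1, p.2 + h) - (F (p.1 + h, p.2) - F (p.1, p.2))
    = h * h * Fuv q].
Proof.
move=> dF /andP[h0 he].
have be (c s : R) : c <= s <= c + h -> `|s - c| < e.
  by rewrite ltr_norml => /andP[? ?]; apply/andP; split; lra.
have cc (c : R) : c <= c <= c + h by apply/andP; split; lra.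
have cd (c : R) : c <= c + h <= c + h by apply/andP; split; lra.
pose G s := F (s, p.2 + h) - F (s, p.2).
have dG s : p.1 <= s <= p.1 + h ->
    is_derive s 1 G (Fu (s, p.2 + h) - Fu (s, p.2)).
  move=> hs; apply: derv_add; [|apply: derv_opp]; apply: is_derive_fst.
    exact: (dF _ _ (be _ _ hs) (be _ _ (cd _))).1.
  exact: (dF _ _ (be _ _ hs) (be _ _ (cc _))).1.
have [|||x xI Gx] := @MVT R G (fun s => Fu (s, p.2 + h) - Fu (s, p.2)) p.1 (p.1 + h).
- by rewrite ltrDl.
- by move=> s; rewrite in_itv /= => /andP[a b]; apply: dG; rewrite (ltW a) (ltW b).
- apply: derivable_within_continuous => s; rewrite in_itv /= => sI.
  by apply: ex_derive; exact: dG.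
move: xI; rewrite in_itv /= => /andP[x1 x2].
have xI : p.1 <= x <= p.1 + h by rewrite (ltW x1) (ltW x2).
have dK s : p.2 <= s <= p.2 + h -> is_derive s 1 (fun s => Fu (x, s)) (Fuv (x, s)).
  by move=> hs; apply: is_derive_snd; exact: (dF _ _ (be _ _ xI) (be _ _ hs)).2.
have [|||y yI Ky] := @MVT R (fun s => Fu (x, s)) (fun s => Fuv (x, s)) p.2 (p.2 + h).
- by rewrite ltrDl.
- by move=> s; rewrite in_itv /= => /andP[a b]; apply: dK; rewrite (ltW a) (ltW b).
- apply: derivable_within_continuous => s; rewrite in_itv /= => sI.
  by apply: ex_derive; exact: dK.
move: yI; rewrite in_itv /= => /andP[y1 y2].
exists (x, y); split => /=.
- by rewrite ltr_norml; apply/andP; split; lra.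
- by rewrite ltr_norml; apply/andP; split; lra.
have -> : forall a b c d : R, a - b - (c - d) = (a - c) - (b - d) by move=> *; ring.
rewrite -/(G _) in Gx *.
have -> : F (p.1 + h, p.2 + h) - F (p.1 + h, p.2) - (F (p.1, p.2 + h) - F (p.1, p.2))
   = G (p.1 + h) - G p.1 by [].
by rewrite Gx Ky; ring.
Qed.

Definition swap (p : R * R) : R * R := (p.2, p.1).

Lemma is_derive_swap_u (F : R * R -> R) q d :
  is_derive (swap q) (ev R) F d -> is_derive q (eu R) (F \o swap) d.
Proof. exact: is_derive_reparam. Qed.

Lemma is_derive_swap_v (F : R * R -> R) q d :
  is_derive (swap q) (eu R) F d -> is_derive q (ev R) (F \o swap) d.
Proof. exact: is_derive_reparam. Qed.

(** The second difference of [F] over a small square is h^2 times a value of [Fuv] and, with the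
    variables exchanged by [swap], h^2 times a value of [Fvu]. Continuity brings both values to
    [p]. *)
Lemma clairaut D (F Fu Fv Fuu Fuv Fvu Fvv : R * R -> R) : open D ->
  partials D F Fu Fv -> partials D Fu Fuu Fuv -> partials D Fv Fvu Fvv ->
  (forall p, D p -> {for p, continuous Fuv}) ->
  (forall p, D p -> {for p, continuous Fvu}) ->
  forall p, D p -> Fuv p = Fvu p.
Proof.
move=> oD dF dFu dFv cuv cvu p Dp.
apply/eqP; rewrite -subr_eq0 -normr_le0; apply/ler_addgt0Pr => eps eps0.
rewrite add0r.
have e2 : 0 < eps / 2 by rewrite divr_gt0.
have nD : \forall q \near p, D q by exact: open_nbhs_nbhs.
have nuv : \forall q \near p, `|Fuv p - Fuv q| < eps / 2.
  by have /cvgrPdist_lt := cuv _ Dp; apply.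
have nvu : \forall q \near p, `|Fvu p - Fvu q| < eps / 2.
  by have /cvgrPdist_lt := cvu _ Dp; apply.
have /nbhs_box[e e0 He] : nbhs p [set q | [/\ D q, `|Fuv p - Fuv q| < eps / 2 &
    `|Fvu p - Fvu q| < eps / 2]] by apply: filterS3 nD nuv nvu.
pose h := e / 2.
have he : 0 < h < e by rewrite /h; apply/andP; split; lra.
have [h0 hle] := andP he.
have [|q [q1 q2 Eq]] := @second_difference F Fu Fuv p e h _ he.
  by move=> u v hu hv; have [Duv _ _] := He _ _ hu hv; split;
     [exact: (dF _ Duv).1|exact: (dFu _ Duv).2].
have [|r [r1 r2 Er]] :=
    @second_difference (F \o swap) (Fv \o swap) (Fvu \o swap) (swap p) e h _ he.
  move=> u v hu hv; have [Duv _ _] := He _ _ hv hu; split.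
    by apply: is_derive_swap_u; exact: (dF _ Duv).2.
  by apply: is_derive_swap_v; exact: (dFv _ Duv).1.
have EE : Fuv q = Fvu (swap r).
  have hh : h * h != 0 by rewrite mulf_neq0 ?gt_eqF.
  apply: (mulfI hh); rewrite -Eq -[RHS]Er /=; ring.
have [_ A _] := He _ _ (lt_trans q1 hle) (lt_trans q2 hle).
have [_ _ B] := He _ _ (lt_trans r2 hle) (lt_trans r1 hle).
rewrite -surjective_pairing EE in A.
have -> : Fuv p - Fvu p = (Fuv p - Fvu (swap r)) - (Fvu p - Fvu (swap r)) by ring.
rewrite (le_trans (ler_normB _ _)) //.
have : `|Fuv p - Fvu (swap r)| + `|Fvu p - Fvu (swap r)| < eps / 2 + eps / 2.
  exact: ltrD.
by rewrite -splitr => /ltW.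
Qed.

End PlaneCalculus.

#[local] Opaque eu ev derive.

(** * The moving frame of a surface *)

Section FrameAlgebra.
Variable R : realType.

Lemma partials_eq D (F G Fu Fv Gu Gv : R * R -> R) : open D ->
  (forall p, D p -> F p = G p) ->
  partials D F Fu Fv -> partials D G Gu Gv ->
  forall p, D p -> Fu p = Gu p /\ Fv p = Gv p.
Proof.
move=> oD FG dF dG p Dp.
have nFG : \forall q \near p, F q = G q.
  have : \forall q \near p, D q by exact: open_nbhs_nbhs.
  by apply: filterS.
split; [apply: (@is_derive_uniq _ _ _ G p (eu R))|
        apply: (@is_derive_uniq _ _ _ G p (ev R))].
- exact: near_eq_is_derive nFG (dF _ Dp).1.
- exact: (dG _ Dp).1.
- exact: near_eq_is_derive nFG (dF _ Dp).2.
- exact: (dG _ Dp).2.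
Qed.

(** The matrix with rows (a1, a2) and (b1, b2) is e times an orthogonal matrix, so its columns
    satisfy the same relations. *)
Lemma frame_dual (a1 a2 b1 b2 e : R) : e != 0 ->
  a1 ^+ 2 + a2 ^+ 2 = e ^+ 2 -> b1 ^+ 2 + b2 ^+ 2 = e ^+ 2 ->
  a1 * b1 + a2 * b2 = 0 ->
  [/\ a1 ^+ 2 + b1 ^+ 2 = e ^+ 2, a2 ^+ 2 + b2 ^+ 2 = e ^+ 2 &
      a1 * a2 + b1 * b2 = 0].
Proof.
move=> e0 ha hb hab.
have e2 : e ^+ 2 != 0 by rewrite expf_neq0.
have b1a2 : b1 ^+ 2 = a2 ^+ 2.
  apply: (mulfI e2); lincomb ((e ^+ 2 - (a1 ^+ 2 + a2 ^+ 2)) * b1 ^+ 2 +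
    ((b1 ^+ 2 + b2 ^+ 2) - e ^+ 2) * a2 ^+ 2 +
    (a1 * b1 + a2 * b2) * (a1 * b1 - a2 * b2)).
  by rewrite ha hb hab; ring.
split; first by rewrite b1a2.
  by rewrite -b1a2.
apply: (mulfI e2); lincomb ((e ^+ 2 - (a1 ^+ 2 + a2 ^+ 2)) * b1 * b2 +
    (e ^+ 2 - (b1 ^+ 2 + b2 ^+ 2)) * a1 * a2 +
    (a1 * b1 + a2 * b2) * (a1 * b2 + a2 * b1)).
by rewrite ha hb hab; ring.
Qed.

Lemma frame_expand (a1 a2 b1 b2 e x y s t : R) : e != 0 ->
  a1 ^+ 2 + a2 ^+ 2 = e ^+ 2 -> b1 ^+ 2 + b2 ^+ 2 = e ^+ 2 ->
  a1 * b1 + a2 * b2 = 0 ->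
  x * a1 + y * a2 = e * s -> x * b1 + y * b2 = e * t ->
  x = (s * a1 + t * b1) / e /\ y = (s * a2 + t * b2) / e.
Proof.
move=> e0 ha hb hab hs ht.
have [h1 h2 h12] := frame_dual e0 ha hb hab.
have e2 : e ^+ 2 != 0 by rewrite expf_neq0.
split; apply: (mulIf e0); rewrite divfK //; apply: (mulfI e0).
- lincomb (x * (e ^+ 2 - (a1 ^+ 2 + b1 ^+ 2)) - y * (a1 * a2 + b1 * b2) +
    (x * a1 + y * a2 - e * s) * a1 + (x * b1 + y * b2 - e * t) * b1).
  by rewrite h1 h12 hs ht; ring.
- lincomb (y * (e ^+ 2 - (a2 ^+ 2 + b2 ^+ 2)) - x * (a1 * a2 + b1 * b2) +
    (x * a1 + y * a2 - e * s) * a2 + (x * b1 + y * b2 - e * t) * b2).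
  by rewrite h2 h12 hs ht; ring.
Qed.

Lemma frame_free (a1 a2 b1 b2 e s t : R) : e != 0 ->
  a1 ^+ 2 + a2 ^+ 2 = e ^+ 2 -> b1 ^+ 2 + b2 ^+ 2 = e ^+ 2 ->
  a1 * b1 + a2 * b2 = 0 ->
  s * a1 + t * b1 = 0 -> s * a2 + t * b2 = 0 -> s = 0 /\ t = 0.
Proof.
move=> e0 ha hb hab h1 h2.
have e2 : e ^+ 2 != 0 by rewrite expf_neq0.
split; apply: (mulfI e2).
- lincomb ((e ^+ 2 - (a1 ^+ 2 + a2 ^+ 2)) * s + (s * a1 + t * b1) * a1 +
    (s * a2 + t * b2) * a2 - t * (a1 * b1 + a2 * b2)).
  by rewrite ha h1 h2 hab; ring.
- lincomb ((e ^+ 2 - (b1 ^+ 2 + b2 ^+ 2)) * t + (s * a1 + t * b1) * b1 +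
    (s * a2 + t * b2) * b2 - s * (a1 * b1 + a2 * b2)).
  by rewrite hb h1 h2 hab; ring.
Qed.

(* Gauss-Weingarten equations for E = e^omega, f = E_u, g = E_v in conformal curvature
   line coordinates.  The sign c is 1 when Q = -1/2 and changes under (u, v) |-> (v, u). *)
Record frame (D : set (R * R)) (c : R) (X Xu Xv : R * R -> 'cV[R]_4)
    (E f g fu fv gu gv : R * R -> R) : Prop := Frame {
  frame_open : open D;
  frame_connected : connected D;
  frame_c : c ^+ 2 = 1;
  frame_gt0 : forall p, D p -> 0 < E p;
  frame_dE : partials D E f g;
  frame_df : partials D f fu fv;
  frame_dg : partials D g gu gv;
  frame_sym : forall p, D p -> fv p = gu p;
  frame_harm : forall p, D p -> E p * (fu p + gv p) = f p ^+ 2 + g p ^+ 2;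
  frame_I3 : forall p, D p -> X p 3%:R 0 = X p 0 0;
  frame_uu : forall p, D p -> Xu p 1 0 ^+ 2 + Xu p 2%:R 0 ^+ 2 = E p ^+ 2;
  frame_vv : forall p, D p -> Xv p 1 0 ^+ 2 + Xv p 2%:R 0 ^+ 2 = E p ^+ 2;
  frame_uv : forall p, D p -> Xu p 1 0 * Xv p 1 0 + Xu p 2%:R 0 * Xv p 2%:R 0 = 0;
  frame_dX : forall i, partials D (fun p => X p i 0) (fun p => Xu p i 0) (fun p => Xv p i 0);
  frame_dXu : forall i, partials D (fun p => Xu p i 0)
    (fun p => (f p * Xu p i 0 - g p * Xv p i 0) / E p - c * pp R i 0)
    (fun p => (g p * Xu p i 0 + f p * Xv p i 0) / E p);
  frame_dXv : forall i, partials D (fun p => Xv p i 0)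
    (fun p => (g p * Xu p i 0 + f p * Xv p i 0) / E p)
    (fun p => (g p * Xv p i 0 - f p * Xu p i 0) / E p + c * pp R i 0)
}.

Lemma derv_mx (F : R * R -> 'cV[R]_4) p v i : derivable F p v ->
  is_derive p v (fun q => F q i 0) ('D_v F p i 0).
Proof.
move=> dF; rewrite (derive_mx dF) mxE; apply: derivableP.
exact: (derivable_mxP _ _ _).1.
Qed.

Lemma mink4 (Y Z : 'cV[R]_4) : mink Y Z =
  - (Y 0 0 * Z 0 0) + (Y 1 0 * Z 1 0 + Y 2%:R 0 * Z 2%:R 0 + Y 3%:R 0 * Z 3%:R 0).
Proof.
rewrite /mink big_mkcond !big_ord_recl big_ord0 /=.
rewrite (_ : lift ord0 ord0 = 1); last exact/val_inj.
rewrite (_ : lift ord0 (lift ord0 ord0) = 2%:R); last exact/val_inj.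
rewrite (_ : lift ord0 (lift ord0 (lift ord0 ord0)) = 3%:R); last exact/val_inj.
by rewrite add0r addr0 !addrA.
Qed.

(** The factor [Z 3%:R 0 - Z 0 0] is <Z, p>. It is 0 for tangent vectors, which leaves the Euclidean
    product of the (x, y)-parts, and 1 for the lightlike normal, which isolates the l-component of
    [Y]. *)
Lemma mink_I3 (Y Z : 'cV[R]_4) : Y 3%:R 0 = Y 0 0 ->
  mink Y Z = Y 0 0 * (Z 3%:R 0 - Z 0 0) + (Y 1 0 * Z 1 0 + Y 2%:R 0 * Z 2%:R 0).
Proof. by move=> Y3; rewrite mink4 Y3; ring. Qed.

Lemma ppE : [/\ pp R 0 0 = 1, pp R 1 0 = 0, pp R 2%:R 0 = 0 & pp R 3%:R 0 = 1].
Proof. by rewrite /pp /vec4; split; rewrite mxE. Qed.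

Lemma I3P (Y : 'cV[R]_4) : I3 Y <-> Y 3%:R 0 = Y 0 0.
Proof.
have [p0 p1 p2 p3] := ppE; rewrite /I3 /= mink4 p0 p1 p2 p3.
split=> [/eqP|->]; last by ring.
by rewrite !mulr0 !mulr1 !add0r addrC subr_eq0 => /eqP.
Qed.

End FrameAlgebra.

(** * Iterated derivatives and their symmetry *)

Section Jets.
Variable R : realType.

Lemma ord4P (P : 'I_4 -> Prop) : P 0 -> P 1 -> P 2%:R -> P 3%:R -> forall i, P i.
Proof.
move=> P0 P1 P2 P3 [[|[|[|[|//]]]] Hi].
- by rewrite (_ : Ordinal Hi = 0) //; exact/val_inj.
- by rewrite (_ : Ordinal Hi = 1) //; exact/val_inj.
- by rewrite (_ : Ordinal Hi = 2%:R) //; exact/val_inj.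
- by rewrite (_ : Ordinal Hi = 3%:R) //; exact/val_inj.
Qed.

Lemma is_derive_open_eq D (F G : R * R -> R) p v a b : open D -> D p ->
  (forall q, D q -> F q = G q) ->
  is_derive p v F a -> is_derive p v G b -> a = b.
Proof.
move=> oD Dp FG dF dG; apply: is_derive_uniq dG.
apply: near_eq_is_derive dF.
have : \forall q \near p, D q by exact: open_nbhs_nbhs.
by apply: filterS.
Qed.

Lemma minkC (Y Z : 'cV[R]_4) : mink Y Z = mink Z Y.
Proof.
by rewrite /mink mulrC; congr (_ + _); apply: eq_bigr => i _; rewrite mulrC.
Qed.

Section Jets.
Variables (D : set (R * R)) (X : R * R -> 'cV[R]_4).
Hypotheses (oD : open D) (sX : smooth_on D X).

(** The head of the list is the derivative taken last. *)
Definition jet (s : seq (R * R)) : R * R -> 'cV[R]_4 :=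
  foldr (fun w (G : R * R -> 'cV[R]_4) => 'D_w G) X s.

Lemma jet_partials s i : partials D (fun q => jet s q i 0)
  (fun q => jet (eu R :: s) q i 0) (fun q => jet (ev R :: s) q i 0).
Proof.
by move=> p Dp; split; apply: derv_mx; apply: diff_derivable; exact: sX.
Qed.

Lemma jet_sym s i p : D p ->
  jet [:: ev R, eu R & s] p i 0 = jet [:: eu R, ev R & s] p i 0.
Proof.
have cj t q : D q -> {for q, continuous (fun x => jet t x i 0)}.
  move=> Dq; have /differentiable_continuous h := @sX t q Dq.
  by apply: (@continuous_comp _ _ _ (jet t) (fun M : 'cV[R]_4 => M i 0)) => //;
     exact: coord_continuous.
exact: (clairaut oD (jet_partials s i) (jet_partials (eu R :: s) i)
  (jet_partials (ev R :: s) i) (cj _) (cj _)).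
Qed.

End Jets.

Lemma hopfP (X n : R * R -> 'cV[R]_4) (w : R * R -> R) p :
  mean_curvature X n w p = 0 -> hopf X n p = - 2^-1 ->
  [/\ sff_L X n p = -1, sff_M X n p = 0 & sff_N X n p = 1].
Proof.
rewrite /mean_curvature /hopf.
move: (sff_L X n p) (sff_M X n p) (sff_N X n p) => L M N.
move=> /eqP; rewrite !mulf_eq0 invr_eq0 pnatr_eq0 /= gt_eqF ?expR_gt0 //= => /eqP LN.
have re : forall k : nat, (k.+1%:R^-1 : R[i]) = (k.+1%:R^-1)%:C%C.
  by move=> k; rewrite -(rmorph_nat (real_complex R)) fmorphV.
rewrite !re -(rmorph_nat (real_complex R) 2) /=.
move=> /eqP; rewrite eq_complex /= => /andP[/eqP h1 /eqP h2].
by split; lra.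
Qed.

End Jets.

(** * Gauss-Weingarten equations of the surface and their integrability *)

Section SurfaceFrame.
Variable R : realType.

(** The names have the symmetry of mixed derivatives built in: [Xuv] is also the u-derivative of
    [Xv], and [Xuuv] that of [Xuv]. The integrability condition compares derivatives of third
    order. *)
Lemma surface_jets (D : set (R * R)) (X : R * R -> 'cV[R]_4) :
  open D -> smooth_on D X ->
  exists Xu Xv Xuu Xuv Xvv Xuuu Xuuv Xuvv : R * R -> 'cV[R]_4,
  let pd F Fu Fv := forall i, partials D (fun q => (F q : 'cV[R]_4) i 0)
      (fun q => (Fu q : 'cV[R]_4) i 0) (fun q => (Fv q : 'cV[R]_4) i 0) in
  pd X Xu Xv /\ pd Xu Xuu Xuv /\ pd Xv Xuv Xvv /\ pd Xuu Xuuu Xuuv /\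
  pd Xuv Xuuv Xuvv /\
  ((forall p, 'D_(eu R) X p = Xu p) /\ (forall p, 'D_(ev R) X p = Xv p)) /\
  [/\ forall p, 'D_(eu R) ('D_(eu R) X) p = Xuu p,
      forall p, 'D_(ev R) ('D_(eu R) X) p = Xuv p &
      forall p, 'D_(ev R) ('D_(ev R) X) p = Xvv p].
Proof.
move=> oD sX; have jp := jet_partials sX.
exists (jet X [:: eu R]), (jet X [:: ev R]), (jet X [:: eu R; eu R]),
  (jet X [:: ev R; eu R]), (jet X [:: ev R; ev R]), (jet X [:: eu R; eu R; eu R]),
  (jet X [:: ev R; eu R; eu R]), (jet X [:: ev R; ev R; eu R]) => pd.
split; first exact: (jp [::]).
split; first exact: (jp [:: eu R]).
split.
  move=> i p Dp; have [d1 d2] := jp [:: ev R] i p Dp; split; last exact: d2.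
  exact (is_derive_eq d1 (esym (jet_sym oD sX [::] i Dp))).
split; first exact: (jp [:: eu R; eu R]).
split.
  move=> i p Dp; have [d1 d2] := jp [:: ev R; eu R] i p Dp; split; last exact: d2.
  exact (is_derive_eq d1 (esym (jet_sym oD sX [:: eu R] i Dp))).
by [].
Qed.

(** One coordinate of (X_uu)_v = (X_uv)_u, in the shape given by the product rule; [a], [b], [c] are
    the components of X_u, X_v and p. The terms in p cancel. By independence of X_u and X_v the
    remaining coefficients vanish, which gives f_v = g_u and the harmonicity of omega. *)
Lemma codazzi_alg (e f g fu fv gu gv a b c : R) : e != 0 ->
  (fv * a + f * ((g * a + f * b) / e) + - (gv * b + g * ((g * b - f * a) / e + c))) * e^-1
    + (f * a - g * b) * - (g / e ^+ 2) + 0 =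
  (gu * a + g * ((f * a - g * b) / e - c) + (fu * b + f * ((g * a + f * b) / e))) * e^-1
    + (g * a + f * b) * - (f / e ^+ 2) ->
  e * (fv - gu) * a + (f ^+ 2 + g ^+ 2 - e * (fu + gv)) * b = 0.
Proof.
move=> e0 /eqP; rewrite -subr_eq0 => /eqP h.
rewrite -[RHS](mulr0 (e ^+ 2)) -{}h; field; exact: e0.
Qed.

Lemma frame_of_surface (Sigma : set (R * R)) (X n : R * R -> 'cV[R]_4)
    (omega : R * R -> R) :
  open Sigma -> connected Sigma -> spacelike_immersion Sigma X ->
  conformal_factor Sigma X omega -> lightlike_gauss_map Sigma X n ->
  (forall p, Sigma p -> mean_curvature X n omega p = 0) ->
  (forall p, Sigma p -> hopf X n p = - 2^-1) ->
  exists Xu Xv f g fu fv gu gv,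
    frame Sigma 1 X Xu Xv (fun p => expR (omega p)) f g fu fv gu gv.
Proof.
move=> oS cS [sX XI3 _ _] hw hn hH hQ.
have X3 p : Sigma p -> X p 3%:R 0 = X p 0 0 by move=> /XI3/I3P.
have [Xu [Xv [Xuu [Xuv [Xvv [Xuuu [Xuuv [Xuvv [dX [dXu [dXv [dXuu [dXuv
  [[DXu DXv] [DXuu DXuv DXvv]]]]]]]]]]]]]]] := surface_jets oS sX.
pose E p := expR (omega p).
have E0 p : 0 < E p by exact: expR_gt0.
have En p : E p != 0 by rewrite gt_eqF.
have tl3 F Fu Fv : (forall i, partials Sigma (fun q => (F q : 'cV[R]_4) i 0)
      (fun q => (Fu q : 'cV[R]_4) i 0) (fun q => (Fv q : 'cV[R]_4) i 0)) ->
    (forall p, Sigma p -> F p 3%:R 0 = F p 0 0) ->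
    forall p, Sigma p -> Fu p 3%:R 0 = Fu p 0 0 /\ Fv p 3%:R 0 = Fv p 0 0.
  by move=> dF F3 p Sp; exact: (partials_eq oS F3 (dF 3%:R) (dF 0) Sp).
have X3' := tl3 _ _ _ dX X3.
have Xu3 := tl3 _ _ _ dXu (fun p Sp => (X3' p Sp).1).
have Xv3 := tl3 _ _ _ dXv (fun p Sp => (X3' p Sp).2).
have uu p : Sigma p -> Xu p 1 0 ^+ 2 + Xu p 2%:R 0 ^+ 2 = E p ^+ 2.
  move=> Sp; have [+ _ _] := hw p Sp; rewrite DXu.
  rewrite mink_I3; last exact: (X3' p Sp).1.
  by rewrite (X3' p Sp).1 subrr mulr0 add0r !expr2 /E -expRD mulr_natl mulr2n.
have vv p : Sigma p -> Xv p 1 0 ^+ 2 + Xv p 2%:R 0 ^+ 2 = E p ^+ 2.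
  move=> Sp; have [_ + _] := hw p Sp; rewrite DXv.
  rewrite mink_I3; last exact: (X3' p Sp).2.
  by rewrite (X3' p Sp).2 subrr mulr0 add0r !expr2 /E -expRD mulr_natl mulr2n.
have uv p : Sigma p -> Xu p 1 0 * Xv p 1 0 + Xu p 2%:R 0 * Xv p 2%:R 0 = 0.
  move=> Sp; have [_ _] := hw p Sp.
  rewrite DXu DXv.
  rewrite mink_I3; last exact: (X3' p Sp).1.
  by rewrite (X3' p Sp).2 subrr mulr0 add0r.
(* Differentiating E^2 = X_u . X_u, the product of the horizontal parts, gives E E_u = X_u . X_uu
   and E E_v = X_u . X_uv. The quotients serve as definitions because [omega] is not yet known to be
   differentiable. *)
pose f p := (Xu p 1 0 * Xuu p 1 0 + Xu p 2%:R 0 * Xuu p 2%:R 0) / E p.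
pose g p := (Xu p 1 0 * Xuv p 1 0 + Xu p 2%:R 0 * Xuv p 2%:R 0) / E p.
have fE p : Xu p 1 0 * Xuu p 1 0 + Xu p 2%:R 0 * Xuu p 2%:R 0 = f p * E p.
  by rewrite /f divfK.
have gE p : Xu p 1 0 * Xuv p 1 0 + Xu p 2%:R 0 * Xuv p 2%:R 0 = g p * E p.
  by rewrite /g divfK.
have dE : partials Sigma E f g.
  pose P (p : R * R) := Xu p 1 0 * Xu p 1 0 + Xu p 2%:R 0 * Xu p 2%:R 0.
  have PE p : Sigma p -> P p = E p ^+ 2 by move=> Sp; rewrite -uu.
  (* On [Sigma], omega is half the logarithm of an expression in X; the differentiability of E comes
     from here. *)
  have lnP p : Sigma p -> ln (P p) * 2^-1 = omega p.
    by move=> Sp; rewrite PE // -expRM_natl expRK; field.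
  have dP p v d a1 a2 : Sigma p -> is_derive p v (fun q => Xu q 1 0) a1 ->
      is_derive p v (fun q => Xu q 2%:R 0) a2 ->
      Xu p 1 0 * a1 + Xu p 2%:R 0 * a2 = d * E p -> is_derive p v E d.
    move=> Sp d1 d2 dd.
    have Pp : 0 < P p by rewrite PE // exprn_gt0.
    have dP : is_derive p v P _ := derv_add (derv_mul d1 d1) (derv_mul d2 d2).
    have dL := derv_exp (derv_mul (derv_comp (is_derive1_ln Pp) dP) (derv_cst p v 2^-1)).
    have : is_derive p v (fun q => expR (ln (P q) * 2^-1)) d.
      apply: (is_derive_eq dL).
      rewrite /= (lnP p Sp) -/(E p) (PE p Sp).
      have -> : a1 * Xu p 1 0 + Xu p 1 0 * a1 + (a2 * Xu p 2%:R 0 + Xu p 2%:R 0 * a2) =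
         2 * (Xu p 1 0 * a1 + Xu p 2%:R 0 * a2) by ring.
      by rewrite dd; field; exact: En.
    apply: near_eq_is_derive.
    have : \forall q \near p, Sigma q by exact: open_nbhs_nbhs.
    by apply: filterS => q Sq; rewrite (lnP q Sq).
  move=> p Sp; split.
    exact: (dP _ _ _ _ _ Sp (dXu 1 p Sp).1 (dXu 2%:R p Sp).1 (fE p)).
  exact: (dP _ _ _ _ _ Sp (dXu 1 p Sp).2 (dXu 2%:R p Sp).2 (gE p)).
(* Differentiating X_v . X_v = E^2, and then X_u . X_v = 0, completes the products of second
   derivatives with X_u and X_v, that is, the Christoffel symbols of the conformal metric. *)
have vvd p : Sigma p ->
    Xv p 1 0 * Xuv p 1 0 + Xv p 2%:R 0 * Xuv p 2%:R 0 = f p * E p /\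
    Xv p 1 0 * Xvv p 1 0 + Xv p 2%:R 0 * Xvv p 2%:R 0 = g p * E p.
  move=> Sp; have eqv q : Sigma q -> Xv q 1 0 * Xv q 1 0 + Xv q 2%:R 0 * Xv q 2%:R 0 =
    E q * E q by move=> Sq; rewrite -!expr2 vv.
  have [d1 d2] := dXv 1 p Sp; have [d3 d4] := dXv 2%:R p Sp; have [d5 d6] := dE p Sp.
  have := is_derive_open_eq oS Sp eqv (derv_add (derv_mul d1 d1) (derv_mul d3 d3)) (derv_mul d5 d5).
  have := is_derive_open_eq oS Sp eqv (derv_add (derv_mul d2 d2) (derv_mul d4 d4)) (derv_mul d6 d6).
  by move=> /= h1 h2; split; lra.
have uvd p : Sigma p ->
    Xuu p 1 0 * Xv p 1 0 + Xuu p 2%:R 0 * Xv p 2%:R 0 = E p * - g p /\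
    Xvv p 1 0 * Xu p 1 0 + Xvv p 2%:R 0 * Xu p 2%:R 0 = E p * - f p.
  move=> Sp.
  have [d1 d2] := dXv 1 p Sp; have [d3 d4] := dXv 2%:R p Sp.
  have [d5 d6] := dXu 1 p Sp; have [d7 d8] := dXu 2%:R p Sp.
  have := is_derive_open_eq oS Sp uv (derv_add (derv_mul d5 d1) (derv_mul d7 d3)) (derv_cst _ _ _).
  have := is_derive_open_eq oS Sp uv (derv_add (derv_mul d6 d2) (derv_mul d8 d4)) (derv_cst _ _ _).
  have := gE p; have [] := vvd p Sp.
  by move=> /= h1 h2 h3 h4 h5; split; lra.
have gauss p : Sigma p -> [/\ mink (Xuu p) (n p) = -1, mink (Xuv p) (n p) = 0 &
    mink (Xvv p) (n p) = 1].
  move=> Sp; have := hopfP (hH p Sp) (hQ p Sp).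
  by rewrite -(DXuu p) -(DXuv p) -(DXvv p).
have dn p : Sigma p -> mink (Xu p) (n p) = 0 /\ mink (Xv p) (n p) = 0.
  move=> Sp; have [_ h _] := hn p Sp.
  have dXp : differentiable X p by exact: (sX [::] p Sp).
  by rewrite -DXu -DXv !deriveE.
have n03 p : Sigma p -> n p 3%:R 0 - n p 0 0 = 1.
  move=> Sp; have [_ _] := hn p Sp; have [p0 p1 p2 p3] := @ppE R.
  by rewrite minkC mink_I3 ?p0 ?p3 // p1 p2 !mul0r addr0 addr0 mul1r.
have exp1 p : Sigma p -> forall i, i = 1 \/ i = 2%:R ->
    [/\ Xuu p i 0 = (f p * Xu p i 0 - g p * Xv p i 0) / E p,
        Xuv p i 0 = (g p * Xu p i 0 + f p * Xv p i 0) / E p &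
        Xvv p i 0 = (g p * Xv p i 0 - f p * Xu p i 0) / E p].
  move=> Sp; have [v1 v2] := vvd p Sp; have [w1 w2] := uvd p Sp.
  have ex := @frame_expand R _ _ _ _ _ _ _ _ _ (En p) (uu p Sp) (vv p Sp) (uv p Sp).
  have [a1 a2] : Xuu p 1 0 = (f p * Xu p 1 0 + - g p * Xv p 1 0) / E p /\
     Xuu p 2%:R 0 = (f p * Xu p 2%:R 0 + - g p * Xv p 2%:R 0) / E p.
    by apply: ex => //; have := fE p => ?; lra.
  have [b1 b2] : Xuv p 1 0 = (g p * Xu p 1 0 + f p * Xv p 1 0) / E p /\
     Xuv p 2%:R 0 = (g p * Xu p 2%:R 0 + f p * Xv p 2%:R 0) / E p.
    by apply: ex => //; have := gE p => ?; lra.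
  have [c1 c2] : Xvv p 1 0 = (- f p * Xu p 1 0 + g p * Xv p 1 0) / E p /\
     Xvv p 2%:R 0 = (- f p * Xu p 2%:R 0 + g p * Xv p 2%:R 0) / E p.
    by apply: ex => //; lra.
  move=> i [] ->; [rewrite a1 b1 c1|rewrite a2 b2 c2]; split=> //;
    congr (_ / _); ring.
(* Since <n, p> = 1, pairing with [n] expresses an l-component by the horizontal part. For second
   derivatives the values L, M, N = -1, 0, 1 enter too and produce the terms -1 and +1. *)
have exp0 p : Sigma p ->
    [/\ Xuu p 0 0 = (f p * Xu p 0 0 - g p * Xv p 0 0) / E p - 1,
        Xuv p 0 0 = (g p * Xu p 0 0 + f p * Xv p 0 0) / E p &
        Xvv p 0 0 = (g p * Xv p 0 0 - f p * Xu p 0 0) / E p + 1].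
  move=> Sp; have [] := gauss p Sp; have [] := dn p Sp.
  rewrite !mink_I3; try by [exact: (X3' p Sp).1|exact: (X3' p Sp).2|
    exact: (Xu3 p Sp).1|exact: (Xu3 p Sp).2|exact: (Xv3 p Sp).2].
  rewrite n03 // !mulr1.
  have [a1 b1 c1] := exp1 p Sp 1 (or_introl erefl).
  have [a2 b2 c2] := exp1 p Sp 2%:R (or_intror erefl).
  rewrite a1 a2 b1 b2 c1 c2.
  move=> /(canRL (addrK _)) -> /(canRL (addrK _)) -> /(canRL (addrK _)) ->.
  move=> /(canRL (addrK _)) -> /(canRL (addrK _)) ->.
  by split; field; exact: En.
have [p0 p1 p2 p3] := @ppE R.
have gw p : Sigma p -> forall i,
    [/\ Xuu p i 0 = (f p * Xu p i 0 - g p * Xv p i 0) / E p - 1 * pp R i 0,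
        Xuv p i 0 = (g p * Xu p i 0 + f p * Xv p i 0) / E p &
        Xvv p i 0 = (g p * Xv p i 0 - f p * Xu p i 0) / E p + 1 * pp R i 0].
  move=> Sp; have h1 := exp1 p Sp; have h0 := exp0 p Sp.
  apply: ord4P.
  - by rewrite p0 !mulr1.
  - by rewrite p1 !mulr0 subr0 addr0; exact: h1 (or_introl erefl).
  - by rewrite p2 !mulr0 subr0 addr0; exact: h1 (or_intror erefl).
  - by rewrite p3 !mulr1 (X3' p Sp).1 (X3' p Sp).2 (Xu3 p Sp).1 (Xu3 p Sp).2
      (Xv3 p Sp).2.
have dXu' i : partials Sigma (fun p => Xu p i 0)
    (fun p => (f p * Xu p i 0 - g p * Xv p i 0) / E p - 1 * pp R i 0)
    (fun p => (g p * Xu p i 0 + f p * Xv p i 0) / E p).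
  by move=> p Sp; have [<- <- _] := gw p Sp i; exact: dXu.
have dXv' i : partials Sigma (fun p => Xv p i 0)
    (fun p => (g p * Xu p i 0 + f p * Xv p i 0) / E p)
    (fun p => (g p * Xv p i 0 - f p * Xu p i 0) / E p + 1 * pp R i 0).
  by move=> p Sp; have [_ <- <-] := gw p Sp i; exact: dXv.
(* Only the existence of the derivatives of [f] and [g], which are quotients of differentiable
   expressions, is recorded; [compat] relates their values. *)
have df : partials Sigma f (fun p => 'D_(eu R) f p) (fun p => 'D_(ev R) f p).
  move=> p Sp; have [Eu Ev] := dE p Sp.
  have [a1 a2] := dXu 1 p Sp; have [b1 b2] := dXu 2%:R p Sp.
  have [c1 c2] := dXuu 1 p Sp; have [d1 d2] := dXuu 2%:R p Sp.
  have [h1 _] := derv_mul (derv_add (derv_mul a1 c1) (derv_mul b1 d1)) (derv_inv (En p) Eu).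
  have [h2 _] := derv_mul (derv_add (derv_mul a2 c2) (derv_mul b2 d2)) (derv_inv (En p) Ev).
  split; [exact (derivableP h1)|exact (derivableP h2)].
have dg : partials Sigma g (fun p => 'D_(eu R) g p) (fun p => 'D_(ev R) g p).
  move=> p Sp; have [Eu Ev] := dE p Sp.
  have [a1 a2] := dXu 1 p Sp; have [b1 b2] := dXu 2%:R p Sp.
  have [c1 c2] := dXuv 1 p Sp; have [d1 d2] := dXuv 2%:R p Sp.
  have [h1 _] := derv_mul (derv_add (derv_mul a1 c1) (derv_mul b1 d1)) (derv_inv (En p) Eu).
  have [h2 _] := derv_mul (derv_add (derv_mul a2 c2) (derv_mul b2 d2)) (derv_inv (En p) Ev).
  split; [exact (derivableP h1)|exact (derivableP h2)].
have compat p : Sigma p -> forall i,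
   (E p * ('D_(ev R) f p - 'D_(eu R) g p)) * Xu p i 0 +
   (f p ^+ 2 + g p ^+ 2 - E p * ('D_(eu R) f p + 'D_(ev R) g p)) * Xv p i 0 = 0.
  move=> Sp i.
  have [fu fv] := df p Sp; have [gu gv] := dg p Sp.
  have [Eu Ev] := dE p Sp.
  have [uu1 uv1] := dXu' i p Sp; have [vu1 vv1] := dXv' i p Sp.
  have e1 := is_derive_open_eq oS Sp (fun q Sq => let: And3 h _ _ := gw q Sq i in h)
    (dXuu i p Sp).2
    (derv_add (derv_mul (derv_add (derv_mul fv uv1) (derv_opp (derv_mul gv vv1))) (derv_inv (En p) Ev)) (derv_cst _ _ _)).
  have e2 := is_derive_open_eq oS Sp (fun q Sq => let: And3 _ h _ := gw q Sq i in h)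
    (dXuv i p Sp).1
    (derv_mul (derv_add (derv_mul gu uu1) (derv_mul fu vu1)) (derv_inv (En p) Eu)).
  by apply: (@codazzi_alg _ _ _ _ _ _ _ _ _ (1 * pp R i 0) (En p)); rewrite -[RHS]e2 -[LHS]e1.
have fin p : Sigma p -> E p * ('D_(ev R) f p - 'D_(eu R) g p) = 0 /\
    f p ^+ 2 + g p ^+ 2 - E p * ('D_(eu R) f p + 'D_(ev R) g p) = 0.
  by move=> Sp; apply: (frame_free (En p) (uu p Sp) (vv p Sp) (uv p Sp));
    exact: compat.
exists Xu, Xv, f, g, (fun p => 'D_(eu R) f p), (fun p => 'D_(ev R) f p),
  (fun p => 'D_(eu R) g p), (fun p => 'D_(ev R) g p).
split=> //.
- by rewrite expr1n.
- by move=> p _; exact: E0.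
- move=> p Sp; have [/eqP + _] := fin p Sp.
  by rewrite mulf_eq0 (negPf (En p)) orFb subr_eq0 => /eqP.
- move=> p Sp; have [_ /eqP] := fin p Sp.
  by rewrite subr_eq0 => /eqP.
Qed.

End SurfaceFrame.

(** * Conformal factors with vanishing mixed derivative *)

Section SeparatedSystem.
Variable R : realType.

(* The equations satisfied by E = e^omega, f = E_u and g = E_v when omega is harmonic
   and E_uv = 0. *)
Record separated_system (D : set (R * R)) (E f g fu gv : R * R -> R) : Prop := SepSys {
  sep_open : open D;
  sep_connected : connected D;
  sep_gt0 : forall p, D p -> 0 < E p;
  sep_dE : partials D E f g;
  sep_df : partials D f fu (fun=> 0);
  sep_dg : partials D g (fun=> 0) gv;
  sep_harm : forall p, D p -> E p * (fu p + gv p) = f p ^+ 2 + g p ^+ 2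
}.

Lemma swapK : cancel (@swap R) (@swap R). Proof. by case. Qed.

Lemma swap_continuous : continuous (@swap R).
Proof.
move=> p U /nbhs_ballP[e e0 He]; apply/nbhs_ballP; exists e => //= -[u v] [hu hv].
by apply: He; split.
Qed.

Lemma open_swap (D : set (R * R)) : open D -> open (@swap R @^-1` D).
Proof. by have /continuousP := swap_continuous; exact. Qed.

Lemma connected_preimage (phi psi : R * R -> R * R) (D : set (R * R)) :
  cancel phi psi -> cancel psi phi -> continuous psi -> connected D ->
  connected (phi @^-1` D).
Proof.
move=> phiK psiK cpsi cD.
have -> : phi @^-1` D = psi @` D.
  apply/seteqP; split=> [p Dp|_ [q Dq <-]]; last by rewrite /preimage /= psiK.
  by exists (phi p).
by apply: connected_continuous_connected => //; exact: continuous_subspaceT.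
Qed.

Lemma partials_swap D (F Fu Fv : R * R -> R) : partials D F Fu Fv ->
  partials (@swap R @^-1` D) (F \o @swap R) (Fv \o @swap R) (Fu \o @swap R).
Proof.
move=> dF p Dp; have [du dv] := dF _ Dp.
by split; [exact: is_derive_swap_u|exact: is_derive_swap_v].
Qed.

Lemma separated_swap D E f g fu gv : separated_system D E f g fu gv ->
  separated_system (@swap R @^-1` D) (E \o @swap R) (g \o @swap R) (f \o @swap R)
    (gv \o @swap R) (fu \o @swap R).
Proof.
case=> oD cD E0 dE df dg hE; split.
- exact: open_swap.
- exact: connected_preimage swapK swapK swap_continuous cD.
- by move=> p /E0.
- exact: partials_swap.
- exact: (partials_swap dg).
- exact: (partials_swap df).
- by move=> p /hE /= h; rewrite addrC h addrC.
Qed.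

Lemma partials_indep_snd D (F Fu : R * R -> R) : open D ->
  partials D F Fu (fun=> 0) -> forall p, D p -> is_derive p (ev R) Fu 0.
Proof.
move=> oD dF p Dp.
have dF' := partials_swap dF.
have := @partials_indep_fst _ _ _ _ (open_swap oD) (fun q Dq => (dF' q Dq).1)
  (fun q Dq => (dF' q Dq).2) (swap p).
rewrite /preimage /= swapK => /(_ Dp) h.
have := @is_derive_swap_v _ (Fu \o @swap R) p 0 h.
by congr (is_derive _ _ _ _); apply/funext => q /=; rewrite swapK.
Qed.

(* K = (f_u - g_v) / E has zero gradient. *)
Lemma separated_curvature D E f g fu gv p0 : D p0 -> separated_system D E f g fu gv ->
  exists K : R, [/\ forall p, D p -> fu p - gv p = K * E p,
    partials D fu (fun p => K * f p) (fun=> 0) &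
    partials D gv (fun=> 0) (fun p => - (K * g p))].
Proof.
move=> Dp0 [oD cD E0 dE df dg hE].
have En p : D p -> E p != 0 by move=> /E0; rewrite lt0r => /andP[].
have dfv := partials_indep_snd oD df.
have dgu : forall p, D p -> is_derive p (eu R) gv 0.
  by apply: (@partials_indep_fst _ D g) => // p /dg [].
(* [fu] and [gv] come without differentiability. Their sum has it, being the quotient [S] by the
   harmonic equation. As [gv] has u-derivative 0 and [fu] has v-derivative 0, each inherits its
   other derivative from [S]. *)
pose S p := (f p * f p + g p * g p) / E p.
have SE p : D p -> S p = fu p + gv p.
  by move=> Dp; apply: (mulIf (En p Dp)); rewrite divfK ?En // [RHS]mulrC hE // !expr2.
pose k p := (fu p - gv p) / E p.
have dS p : D p -> is_derive p (eu R) S (k p * f p) /\ is_derive p (ev R) S (- (k p * g p)).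
  move=> Dp; have [Eu Ev] := dE p Dp; have [fu' fv'] := df p Dp; have [gu' gv'] := dg p Dp.
  have h := hE p Dp; have e0 := En p Dp.
  have h2 : f p ^+ 2 = E p * (fu p + gv p) - g p ^+ 2 by rewrite h addrK.
  split.
    apply: (is_derive_eq (derv_mul (derv_add (derv_mul fu' fu') (derv_mul gu' gu'))
      (derv_inv e0 Eu))); rewrite /k.
    have -> : f p * f p + g p * g p = E p * (fu p + gv p) by rewrite h !expr2.
    by field.
  apply: (is_derive_eq (derv_mul (derv_add (derv_mul fv' fv') (derv_mul gv' gv'))
    (derv_inv e0 Ev))); rewrite /k.
  have -> : f p * f p + g p * g p = E p * (fu p + gv p) by rewrite h !expr2.
  by field.
have nD p : D p -> \forall q \near p, D q by move=> Dp; exact: open_nbhs_nbhs.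
have dfu p : D p -> is_derive p (eu R) fu (k p * f p).
  move=> Dp; have := derv_add (dS p Dp).1 (derv_opp (dgu p Dp)); rewrite oppr0 addr0.
  apply: near_eq_is_derive; have := nD p Dp.
  by apply: filterS => q Dq; rewrite SE // addrK.
have dgv p : D p -> is_derive p (ev R) gv (- (k p * g p)).
  move=> Dp; have := derv_add (dS p Dp).2 (derv_opp (dfv p Dp)); rewrite oppr0 addr0.
  apply: near_eq_is_derive; have := nD p Dp.
  by apply: filterS => q Dq; rewrite SE // addrC addKr.
(* The numerator f_u - g_v has gradient (k f, k g), which is k times the gradient of E. *)
have dk : partials D k (fun=> 0) (fun=> 0).
  move=> p Dp; have [Eu Ev] := dE p Dp; have e0 := En p Dp; split.
    apply: (is_derive_eq (derv_mul (derv_add (dfu p Dp) (derv_opp (dgu p Dp)))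
      (derv_inv e0 Eu))); rewrite /k; by field.
  apply: (is_derive_eq (derv_mul (derv_add (dfv p Dp) (derv_opp (dgv p Dp)))
      (derv_inv e0 Ev))); rewrite /k; by field.
have kc p : D p -> k p = k p0 by exact: partials0_const Dp0.
exists (k p0); split.
- by move=> p Dp; rewrite -(kc p Dp) divfK ?En.
- by move=> p Dp; rewrite -(kc p Dp); split; [exact: dfu|exact: dfv].
- by move=> p Dp; rewrite -(kc p Dp); split; [exact: dgu|exact: dgv].
Qed.

Lemma unit_circle (x y : R) : x ^+ 2 + y ^+ 2 = 1 ->
  exists t, x = cos t /\ y = sin t.
Proof.
move=> h.
have x1 : -1 <= x <= 1.
  by have y0 := sqr_ge0 y; apply/andP; split; nra.
have cx : cos (acos x) = x by apply: acosK; rewrite in_itv.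
have sx : sin (acos x) = Num.sqrt (1 - x ^+ 2) by apply: sin_acos.
have y2 : 1 - x ^+ 2 = y ^+ 2 by lra.
move: sx; rewrite y2 sqrtr_sqr => sx.
have [y0|y0] := leP 0 y; [exists (acos x)|exists (- acos x)].
  by rewrite cx sx ger0_norm.
by rewrite cosN sinN cx sx ltr0_norm // opprK.
Qed.

End SeparatedSystem.

(** * Explicit solutions of the separated system *)

Section SeparatedSolutions.
Variable R : realType.

(** The shifts are removed afterwards by translations. The growing exponential is listed apart
    because it also takes the reflection u -> -u. *)
Lemma classify_separated D E f g fu gv p0 (K : R) :
  D p0 -> separated_system D E f g fu gv ->
  (forall p, D p -> fu p - gv p = K * E p) ->
  partials D fu (fun p => K * f p) (fun=> 0) ->
  partials D gv (fun=> 0) (fun p => - (K * g p)) -> 0 <= K ->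
  [\/ forall p, D p -> f p = 0 /\ g p = 0,
      exists a u0 : R, 0 < a /\
        ((forall p, D p -> f p = - expR (- (a * (p.1 + u0))) /\ g p = 0) \/
         (forall p, D p -> f p = expR (a * (p.1 + u0)) /\ g p = 0)),
      exists b u0 v0 : R, 0 < b /\
        forall p, D p -> f p = b * (p.1 + u0) /\ g p = b * (p.2 + v0) |
      exists a b u0 v0 : R, [/\ 0 < a, 0 < b &
        forall p, D p -> f p = b / a * sinh (a * (p.1 + u0)) /\
                         g p = b / a * sin (a * (p.2 + v0))]].
Proof.
move=> Dp0 [oD cD E0 dE df dg hE] KE dfu dgv.
have cst F : partials D F (fun=> 0) (fun=> 0) -> forall p, D p -> F p = F p0.
  by move=> dF p Dp; exact: (partials0_const oD cD dF).
rewrite le_eqVlt => /orP[/eqP K0|K0].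
  have fuc : forall p, D p -> fu p = fu p0.
    by apply: cst => p /dfu; rewrite -K0 mul0r.
  have gvc : forall p, D p -> gv p = fu p0.
    move=> p Dp; rewrite -(fuc p Dp); have := KE p Dp.
    by rewrite -K0 mul0r => /eqP; rewrite subr_eq0 => /eqP.
  pose b := fu p0.
  have h p : D p -> E p * (b + b) = f p ^+ 2 + g p ^+ 2.
    by move=> Dp; rewrite -hE // fuc // gvc.
  (* 2 b E = f^2 + g^2 with E > 0 excludes b < 0, and b = 0 forces f = g = 0. *)
  have [b0|b0|b0] := ltrgtP 0 b.
  - apply: Or43.
    have fc : forall p, D p -> f p - b * p.1 = f p0 - b * p0.1.
      apply: (cst (fun p => f p - b * p.1)) => p Dp; have [d1 d2] := df p Dp; split.
        apply: (is_derive_eq (derv_add d1 (derv_opp (derv_mul (derv_cst _ _ b) (derv_fst _ _))))).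
        by rewrite dirE (fuc p Dp) -/b; ring.
      apply: (is_derive_eq (derv_add d2 (derv_opp (derv_mul (derv_cst _ _ b) (derv_fst _ _))))).
      by rewrite dirE; ring.
    have gc : forall p, D p -> g p - b * p.2 = g p0 - b * p0.2.
      apply: (cst (fun p => g p - b * p.2)) => p Dp; have [d1 d2] := dg p Dp; split.
        apply: (is_derive_eq (derv_add d1 (derv_opp (derv_mul (derv_cst _ _ b) (derv_snd _ _))))).
        by rewrite dirE; ring.
      apply: (is_derive_eq (derv_add d2 (derv_opp (derv_mul (derv_cst _ _ b) (derv_snd _ _))))).
      by rewrite dirE (gvc p Dp) -/b; ring.
    have bn : b != 0 by rewrite gt_eqF.
    exists b, ((f p0 - b * p0.1) / b), ((g p0 - b * p0.2) / b); split=> // p Dp.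
    by split; [rewrite -(fc p Dp)|rewrite -(gc p Dp)]; field; exact: bn.
  - exfalso; have := h p0 Dp0; have := E0 p0 Dp0.
    by have := sqr_ge0 (f p0); have := sqr_ge0 (g p0) => ? ? ? ?; nra.
  - apply: Or41 => p Dp; have := h p Dp; rewrite -b0 addr0 mulr0 => /esym/eqP.
    by rewrite paddr_eq0 ?sqr_ge0 // !sqrf_eq0 => /andP[/eqP -> /eqP ->].
pose a := Num.sqrt K.
have a0 : 0 < a by rewrite sqrtr_gt0.
have an : a != 0 by rewrite gt_eqF.
have aK : K = a * a by rewrite -expr2 sqr_sqrtr // ltW.
(* First integrals: [A] and [B] are the coefficients in f_u + a f = A exp(a u) and f_u - a f = B
   exp(- a u). The vector (g_v, a g) turns by the angle a v, and ([C], [S]) is that vector turned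
   back. *)
pose A p := (fu p + a * f p) * expR (- (a * p.1)).
pose B p := (fu p - a * f p) * expR (a * p.1).
pose C p := gv p * cos (a * p.2) + a * g p * sin (a * p.2).
pose S p := a * g p * cos (a * p.2) - gv p * sin (a * p.2).
have da (p v : R * R) := derv_cst p v a.
have Ac : forall p, D p -> A p = A p0.
  apply: cst => p Dp; have [d1 d2] := df p Dp; have [e1 e2] := dfu p Dp; split.
    apply: (is_derive_eq (derv_mul (derv_add e1 (derv_mul (da _ _) d1))
      (derv_exp (derv_opp (derv_mul (da _ _) (derv_fst _ _)))))).
    by rewrite dirE aK; ring.
  apply: (is_derive_eq (derv_mul (derv_add e2 (derv_mul (da _ _) d2))
      (derv_exp (derv_opp (derv_mul (da _ _) (derv_fst _ _)))))).
  by rewrite dirE; ring.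
have Bc : forall p, D p -> B p = B p0.
  apply: cst => p Dp; have [d1 d2] := df p Dp; have [e1 e2] := dfu p Dp; split.
    apply: (is_derive_eq (derv_mul (derv_add e1 (derv_opp (derv_mul (da _ _) d1)))
      (derv_exp (derv_mul (da _ _) (derv_fst _ _))))).
    by rewrite dirE aK; ring.
  apply: (is_derive_eq (derv_mul (derv_add e2 (derv_opp (derv_mul (da _ _) d2)))
      (derv_exp (derv_mul (da _ _) (derv_fst _ _))))).
  by rewrite dirE; ring.
have Cc : forall p, D p -> C p = C p0.
  apply: cst => p Dp; have [d1 d2] := dg p Dp; have [e1 e2] := dgv p Dp; split.
    apply: (is_derive_eq (derv_add
      (derv_mul e1 (derv_cos (derv_mul (da _ _) (derv_snd _ _))))
      (derv_mul (derv_mul (da _ _) d1) (derv_sin (derv_mul (da _ _) (derv_snd _ _)))))).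
    by rewrite dirE; ring.
  apply: (is_derive_eq (derv_add
      (derv_mul e2 (derv_cos (derv_mul (da _ _) (derv_snd _ _))))
      (derv_mul (derv_mul (da _ _) d2) (derv_sin (derv_mul (da _ _) (derv_snd _ _)))))).
  by rewrite dirE aK; ring.
have Sc : forall p, D p -> S p = S p0.
  apply: cst => p Dp; have [d1 d2] := dg p Dp; have [e1 e2] := dgv p Dp; split.
    apply: (is_derive_eq (derv_add
      (derv_mul (derv_mul (da _ _) d1) (derv_cos (derv_mul (da _ _) (derv_snd _ _))))
      (derv_opp (derv_mul e1 (derv_sin (derv_mul (da _ _) (derv_snd _ _))))))).
    by rewrite dirE; ring.
  apply: (is_derive_eq (derv_add
      (derv_mul (derv_mul (da _ _) d2) (derv_cos (derv_mul (da _ _) (derv_snd _ _))))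
      (derv_opp (derv_mul e2 (derv_sin (derv_mul (da _ _) (derv_snd _ _))))))).
  by rewrite dirE aK; ring.
have ee (x : R) : expR (- x) * expR x = 1 by rewrite -expRD addNr expR0.
have fuA p : D p -> fu p + a * f p = A p0 * expR (a * p.1).
  by move=> Dp; rewrite -(Ac p Dp) /A -mulrA ee mulr1.
have fuB p : D p -> fu p - a * f p = B p0 * expR (- (a * p.1)).
  by move=> Dp; rewrite -(Bc p Dp) /B -mulrA [expR (a * _) * _]mulrC ee mulr1.
(* This is f_u^2 - a^2 f^2 = g_v^2 + a^2 g^2, obtained from f_u - g_v = K E by multiplying with f_u
   + g_v and using the harmonic equation. It ties the constants of f to those of g. *)
have AB p : D p -> A p0 * B p0 = gv p ^+ 2 + (a * g p) ^+ 2.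
  move=> Dp; have := hE p Dp; have := KE p Dp; rewrite aK => h1 h2.
  rewrite -(Ac p Dp) -(Bc p Dp) /A /B.
  have -> : (fu p + a * f p) * expR (- (a * p.1)) * ((fu p - a * f p) * expR (a * p.1)) =
    (fu p ^+ 2 - (a * f p) ^+ 2) * (expR (- (a * p.1)) * expR (a * p.1)) by ring.
  rewrite ee mulr1.
  lincomb ((fu p - gv p - a * a * E p) * (fu p + gv p) +
    a * a * (E p * (fu p + gv p) - (f p ^+ 2 + g p ^+ 2))).
  by rewrite h1 h2; ring.
have AB0 : 0 <= A p0 * B p0 by rewrite (AB p0 Dp0) addr_ge0 // sqr_ge0.
have pos : 0 < fu p0 - gv p0 by rewrite KE // mulr_gt0 // E0.
have ex1 := expR_gt0 (a * p0.1); have ex2 := expR_gt0 (- (a * p0.1)).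
have fu0 := fuA p0 Dp0; have fv0 := fuB p0 Dp0.
(* If A B = 0, then g = 0 and one exponential is missing. As f_u - g_v = K E > 0, the other
   coefficient is positive and its logarithm can be absorbed in a shift of u. *)
have [AB1|AB1] := eqVneq (A p0 * B p0) 0.
  have gg p : D p -> gv p = 0 /\ g p = 0.
    move=> Dp; have /esym/eqP := AB p Dp; rewrite AB1 paddr_eq0 ?sqr_ge0 //.
    by rewrite !sqrf_eq0 mulf_eq0 (negPf an) /= => /andP[/eqP -> /eqP ->].
  rewrite (gg p0 Dp0).1 subr0 in pos.
  apply: Or42; exists a.
  move/eqP: AB1; rewrite mulf_eq0 => /orP[/eqP A0|/eqP B0].
    have B0 : 0 < B p0.
      by rewrite A0 mul0r in fu0; rewrite -(pmulr_lgt0 _ ex2) -fv0; lra.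
    pose c := B p0 / (2 * a); have c0 : 0 < c by rewrite divr_gt0 // mulr_gt0.
    exists (- (ln c / a)); split=> //; left => p Dp; split; last by have [] := gg p Dp.
    have -> : - (a * (p.1 - ln c / a)) = - (a * p.1) + ln c by field.
    rewrite expRD lnK ?posrE //.
    have := fuA p Dp; have := fuB p Dp; rewrite A0 mul0r => h1 h2.
    apply: (mulfI (_ : 2 * a != 0)); first by rewrite mulf_neq0 ?pnatr_eq0.
    have -> : 2 * a * f p = (fu p + a * f p) - (fu p - a * f p) by ring.
    by rewrite h1 h2 /c; field.
  have A0 : 0 < A p0.
    by rewrite B0 mul0r in fv0; rewrite -(pmulr_lgt0 _ ex1) -fu0; lra.
  pose c := A p0 / (2 * a); have c0 : 0 < c by rewrite divr_gt0 // mulr_gt0.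
  exists (ln c / a); split=> //; right => p Dp; split; last by have [] := gg p Dp.
  have -> : a * (p.1 + ln c / a) = a * p.1 + ln c by field.
  rewrite expRD lnK ?posrE //.
  have := fuA p Dp; have := fuB p Dp; rewrite B0 mul0r => h1 h2.
  apply: (mulfI (_ : 2 * a != 0)); first by rewrite mulf_neq0 ?pnatr_eq0.
  have -> : 2 * a * f p = (fu p + a * f p) - (fu p - a * f p) by ring.
  by rewrite h1 h2 /c; field.
have AB2 : 0 < A p0 * B p0 by rewrite lt_neqAle eq_sym AB1.
(* If both were negative, then f_u < 0, so g_v < f_u < 0 by [pos] and g_v^2 > f_u^2, against f_u^2 =
   a^2 f^2 + g_v^2 + a^2 g^2. *)
have A0 : 0 < A p0.
  rewrite ltNge; apply/negP => A0.
  have A1 : A p0 < 0.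
    by rewrite lt_neqAle A0 andbT; apply: contraNneq AB1 => ->; rewrite mul0r.
  have B1 : B p0 < 0 by rewrite -(nmulr_rgt0 _ A1).
  have f1 : fu p0 + a * f p0 < 0 by rewrite fu0 nmulr_rlt0.
  have f2 : fu p0 - a * f p0 < 0 by rewrite fv0 nmulr_rlt0.
  have h1 : (fu p0 + a * f p0) * (fu p0 - a * f p0) = gv p0 ^+ 2 + (a * g p0) ^+ 2.
    rewrite -(AB p0 Dp0) fu0 fv0 -[LHS]mulrA [expR _ * (_ * _)]mulrCA.
    by rewrite [expR (a * _) * _]mulrC ee mulr1.
  have := sqr_ge0 (a * g p0); have := sqr_ge0 (a * f p0) => s1 s2.
  by nra.
have B0 : 0 < B p0 by rewrite -(pmulr_rgt0 _ A0).
(* The common amplitude, since A B = C^2 + S^2. With A = b exp(a u0), B = b exp(- a u0) and (C, S) =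
   b (cos t, sin t), f_u and g_v are b times cosh and cos of the shifted arguments. *)
pose b := Num.sqrt (A p0 * B p0).
have b0 : 0 < b by rewrite sqrtr_gt0.
have bn : b != 0 by rewrite gt_eqF.
have bb : b * b = A p0 * B p0 by rewrite -expr2 sqr_sqrtr.
have CS : (C p0 / b) ^+ 2 + (S p0 / b) ^+ 2 = 1.
  have cs := cos2Dsin2 (a * p0.2).
  have h : C p0 ^+ 2 + S p0 ^+ 2 = b * b.
    rewrite bb (AB p0 Dp0) -[RHS]mulr1 -cs /C /S; ring.
  by rewrite !expr_div_n -mulrDl h expr2 divff // mulf_neq0.
have [t [Ct St]] := unit_circle CS.
apply: Or44; exists a, b, (ln (A p0 / b) / a), (t / a); split=> // p Dp.
have Ab : 0 < A p0 / b by rewrite divr_gt0.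
split.
  have -> : a * (p.1 + ln (A p0 / b) / a) = a * p.1 + ln (A p0 / b) by field.
  rewrite /sinh opprD !expRD expRN [expR (- ln _)]expRN lnK ?posrE //.
  have h1 := fuA p Dp; have h2 := fuB p Dp.
  apply: (mulfI (_ : 2 * a != 0)); first by rewrite mulf_neq0 ?pnatr_eq0.
  have -> : 2 * a * f p = (fu p + a * f p) - (fu p - a * f p) by ring.
  have An : A p0 != 0 by rewrite gt_eqF.
  have Be : B p0 = b * b / A p0 by rewrite bb mulrC mulKf.
  rewrite h1 h2 Be expRN; field.
  by rewrite an bn An gt_eqF ?expR_gt0.
have -> : a * (p.2 + t / a) = a * p.2 + t by field.
rewrite sinD -Ct -St -(Cc p Dp) -(Sc p Dp) /C /S.
have cs := cos2Dsin2 (a * p.2).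
rewrite -[LHS]mulr1 -cs; field; by rewrite an bn.
Qed.

End SeparatedSolutions.

(** * Changes of coordinates *)

Section CoordinateChanges.
Variable R : realType.

(** From omega = ln E, the derivative of omega is that of E divided by E, and the factor E in [f_of]
    and [g_of] cancels the denominator. *)
Lemma derive_exp_comp (omega : R * R -> R) (phi : R * R -> R * R) p v w d :
  (forall h : R, phi (h *: v + p) = h *: w + phi p) ->
  is_derive (phi p) w (fun q => expR (omega q)) d ->
  'D_v (omega \o phi) p * expR ((omega \o phi) p) = d.
Proof.
move=> phiE dE.
have E0 : 0 < expR (omega (phi p)) by exact: expR_gt0.
have dl := derv_comp (F := fun q => expR (omega q)) (is_derive1_ln E0) dE.
have : is_derive (phi p) w omega ((expR (omega (phi p)))^-1 * d).
  by move: dl; congr (is_derive _ _ _ _); apply/funext => q; rewrite expRK.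
move/(is_derive_reparam phiE) => [_ ->].
by rewrite /= mulrC mulVKf // gt_eqF.
Qed.

(** The induction is on [psi], because the constructors precompose with an elementary change. *)
Lemma coord_change_comp (phi psi : R * R -> R * R) :
  coord_change phi -> coord_change psi -> coord_change (phi \o psi).
Proof.
move=> cphi; elim=> {psi} [//|u0 v0 psi _ IH|psi _ IH|psi _ IH|psi _ IH].
- exact: (coord_trans u0 v0 IH).
- exact: (coord_sign_u IH).
- exact: (coord_sign_v IH).
- exact: (coord_swap IH).
Qed.

Lemma pair_continuous (a b : R * R -> R) : continuous a -> continuous b ->
  continuous (fun p : R * R => (a p, b p)).
Proof.
move=> ca cb p U /nbhs_ballP[e e0 He].
have na : \forall q \near p, ball (a p) e (a q).
  by apply: (ca p); exact: nbhsx_ballx.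
have nb : \forall q \near p, ball (b p) e (b q).
  by apply: (cb p); exact: nbhsx_ballx.
by apply: filterS2 na nb => q h1 h2; apply: He; split.
Qed.

Lemma fst_continuous : continuous (fun p : R * R => p.1).
Proof. by move=> p; exact: cvg_fst. Qed.

Lemma snd_continuous : continuous (fun p : R * R => p.2).
Proof. by move=> p; exact: cvg_snd. Qed.

Lemma coord_change_homeo (phi : R * R -> R * R) : coord_change phi ->
  exists psi : R * R -> R * R,
    [/\ cancel phi psi, cancel psi phi, continuous phi & continuous psi].
Proof.
have step (chi tau sigma : R * R -> R * R) :
    cancel tau sigma -> cancel sigma tau -> continuous tau -> continuous sigma ->
    (exists psi : R * R -> R * R,
      [/\ cancel chi psi, cancel psi chi, continuous chi & continuous psi]) ->
    exists psi : R * R -> R * R,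
      [/\ cancel (chi \o tau) psi, cancel psi (chi \o tau), continuous (chi \o tau) &
          continuous psi].
  move=> ts st ct cs [psi [cp pc cc cpsi]]; exists (sigma \o psi); split.
  - exact: can_comp.
  - exact: can_comp.
  - by move=> p; exact: (continuous_comp (ct p) (cc (tau p))).
  - by move=> p; exact: (continuous_comp (cpsi p) (cs (psi p))).
have cf := fst_continuous; have cs := snd_continuous.
have cN (a : R * R -> R) : continuous a -> continuous (fun p => - a p).
  by move=> ca p; apply: continuousN; exact: ca.
have cD (a : R * R -> R) c : continuous a -> continuous (fun p => a p + c).
  by move=> ca p; apply: continuousD; [exact: ca|exact: cvg_cst].
elim=> {phi} [|u0 v0 phi _|phi _|phi _|phi _].
- by exists id; split=> // p; exact: cvg_id.
- apply: (@step phi (fun p => (p.1 + u0, p.2 + v0)) (fun p => (p.1 - u0, p.2 - v0))).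
  + by move=> [u v] /=; rewrite !addrK.
  + by move=> [u v] /=; rewrite !subrK.
  + by apply: pair_continuous; exact: cD.
  + by apply: pair_continuous; exact: cD.
- apply: (@step phi (fun p => (- p.1, p.2)) (fun p => (- p.1, p.2))).
  + by move=> [u v] /=; rewrite opprK.
  + by move=> [u v] /=; rewrite opprK.
  + by apply: pair_continuous => //; exact: cN.
  + by apply: pair_continuous => //; exact: cN.
- apply: (@step phi (fun p => (p.1, - p.2)) (fun p => (p.1, - p.2))).
  + by move=> [u v] /=; rewrite opprK.
  + by move=> [u v] /=; rewrite opprK.
  + by apply: pair_continuous => //; exact: cN.
  + by apply: pair_continuous => //; exact: cN.
- apply: (@step phi (fun p => (p.2, p.1)) (fun p => (p.2, p.1))) => //.
  + by move=> [].
  + by move=> [].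
  + exact: pair_continuous.
  + exact: pair_continuous.
Qed.

Definition classified (D : set (R * R)) (omega : R * R -> R) : Prop :=
  exists phi : R * R -> R * R, coord_change phi /\
    (case1 (phi @^-1` D) (omega \o phi) \/ case2 (phi @^-1` D) (omega \o phi)).

Lemma separated_classified_pos D omega f g fu gv p0 (K : R) :
  D p0 -> separated_system D (fun p => expR (omega p)) f g fu gv ->
  (forall p, D p -> fu p - gv p = K * expR (omega p)) ->
  partials D fu (fun p => K * f p) (fun=> 0) ->
  partials D gv (fun=> 0) (fun p => - (K * g p)) -> 0 <= K ->
  classified D omega.
Proof.
move=> Dp0 sys KE dfu dgv K0; have [oD cD E0 dE df dg hE] := sys.
have [cst|ncst] := pselect (constant_on D omega).
  by exists id; split; [exact: coord_id|right].
have ncstp phi : coord_change phi -> ~ constant_on (phi @^-1` D) (omega \o phi).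
  move=> /coord_change_homeo[psi [_ psiK _ _]] [c hc]; apply: ncst; exists c => p Dp.
  by have := hc (psi p); rewrite /preimage /= psiK; apply.
pose tr a b : R * R -> R * R := fun p => (p.1 + a, p.2 + b).
have ctr a b : coord_change (tr a b) by exact: (coord_trans a b (coord_id R)).
have tru a b p (h : R) : tr a b (h *: eu R + p) = h *: eu R + tr a b p.
  by rewrite /tr; congr pair; rewrite /= addrA.
have trv a b p (h : R) : tr a b (h *: ev R + p) = h *: ev R + tr a b p.
  by rewrite /tr; congr pair; rewrite /= addrA.
have ftr a b p : D (tr a b p) -> f_of (omega \o tr a b) p = f (tr a b p).
  by move=> Dp; exact: (derive_exp_comp (tru a b p) (dE _ Dp).1).
have gtr a b p : D (tr a b p) -> g_of (omega \o tr a b) p = g (tr a b p).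
  by move=> Dp; exact: (derive_exp_comp (trv a b p) (dE _ Dp).2).
have [|||] := classify_separated Dp0 sys KE dfu dgv K0.
- move=> fg0; exfalso; apply: ncst; exists (omega p0) => p Dp; apply: expR_inj.
  have d0 : partials D (fun q => expR (omega q)) (fun=> 0) (fun=> 0).
    by move=> q Dq; have [d1 d2] := dE q Dq; have [e1 e2] := fg0 q Dq;
       rewrite e1 in d1; rewrite e2 in d2.
  exact: (partials0_const oD cD d0 Dp0 Dp).
- move=> [a [u0 [a0 [H|H]]]].
    exists (tr (- u0) 0); split=> //; left; split; first exact: ncstp.
    apply: Or31; exists a => // p Dp; rewrite ftr // gtr //.
    by have [-> ->] := H _ Dp; rewrite /tr /= subrK.
  (* The [+ 0] is the shape that [coord_sign_u] produces from [tr (- u0) 0]. The reflection reverses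
     both the exponent and the sign of f. *)
  pose s : R * R -> R * R := fun p => (- p.1 - u0, p.2 + 0).
  have cs : coord_change s by exact: (coord_sign_u (ctr (- u0) 0)).
  exists s; split=> //; left; split; first exact: ncstp.
  apply: Or31; exists a => // p Dp; have [h1 h2] := H _ Dp; split.
    have su (h : R) : s (h *: eu R + p) = h *: - eu R + s p.
      rewrite /s scalerN; congr pair; rewrite /= ?dirE.
        by rewrite opprD addrA.
      by rewrite scaler0 oppr0 !add0r.
    rewrite /f_of (derive_exp_comp su (derv_oppdir (dE _ Dp).1)) h1 /s /=.
    by rewrite subrK mulrN.
  have sv (h : R) : s (h *: ev R + p) = h *: ev R + s p.
    rewrite /s; congr pair; rewrite /= ?dirE; last by rewrite addrA.
    by rewrite scaler0 !add0r.
  by rewrite /g_of (derive_exp_comp sv (dE _ Dp).2).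
- move=> [b [u0 [v0 [b0 H]]]].
  exists (tr (- u0) (- v0)); split=> //; left; split; first exact: ncstp.
  apply: Or32; exists b => // p Dp; rewrite ftr // gtr //.
  by have [-> ->] := H _ Dp; rewrite /tr /= !subrK.
- move=> [a [b [u0 [v0 [a0 b0 H]]]]].
  exists (tr (- u0) (- v0)); split=> //; left; split; first exact: ncstp.
  apply: Or33; exists a, b; split=> // p Dp; rewrite ftr // gtr //.
  by have [-> ->] := H _ Dp; rewrite /tr /= !subrK.
Qed.

Lemma separated_classified D omega f g fu gv p0 :
  D p0 -> separated_system D (fun p => expR (omega p)) f g fu gv ->
  classified D omega.
Proof.
move=> Dp0 sys; have [K [KE dfu dgv]] := separated_curvature Dp0 sys.
have [K0|K0] := leP 0 K; first exact: (separated_classified_pos Dp0 sys KE dfu dgv K0).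
have sys' := separated_swap sys.
have [|||||phi [cphi H]] := @separated_classified_pos _ (omega \o @swap R) _ _ _ _
   (swap p0) (- K) _ sys'.
- by rewrite /preimage /= swapK.
- by move=> p Dp /=; rewrite mulNr -KE // opprB.
- move=> p /(partials_swap dgv) [d1 d2]; split=> //.
  by rewrite mulNr; exact: d1.
- move=> p /(partials_swap dfu) [d1 d2]; split=> //.
  by rewrite mulNr opprK; exact: d2.
- by rewrite oppr_ge0 ltW.
exists (@swap R \o phi); split=> //.
by apply: coord_change_comp => //; exact: (coord_swap (coord_id R)).
Qed.

End CoordinateChanges.

(** * Planar curvature lines *)

Section Planarity.
Variable R : realType.

Lemma frame_swap D c (X Xu Xv : R * R -> 'cV[R]_4) (E f g fu fv gu gv : R * R -> R) :
  frame D c X Xu Xv E f g fu fv gu gv ->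
  frame (@swap R @^-1` D) (- c) (X \o @swap R) (Xv \o @swap R) (Xu \o @swap R)
    (E \o @swap R) (g \o @swap R) (f \o @swap R)
    (gv \o @swap R) (gu \o @swap R) (fv \o @swap R) (fu \o @swap R).
Proof.
case=> oD cD c1 E0 dE df dg sy hE X3 uu vv uv dX dXu dXv.
split; rewrite ?sqrrN //.
- exact: open_swap.
- exact (connected_preimage (@swapK R) (@swapK R) (@swap_continuous R) cD).
- by move=> p Dp; exact: E0.
- exact: (partials_swap dE).
- exact: (partials_swap dg).
- exact: (partials_swap df).
- by move=> p Dp; exact/esym/sy.
- by move=> p Dp /=; rewrite addrC hE // addrC.
- by move=> p Dp; exact: X3.
- by move=> p Dp; exact: vv.
- by move=> p Dp; exact: uu.
- by move=> p Dp /=; rewrite -(uv _ Dp); congr (_ + _); rewrite mulrC.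
- by move=> i; exact: (partials_swap (dX i)).
- move=> i p Dp; have [d1 d2] := partials_swap (dXv i) Dp; split.
    by apply: (is_derive_eq d1); rewrite /= mulNr opprK.
  by apply: (is_derive_eq d2); rewrite /= [X in X / _]addrC.
- move=> i p Dp; have [d1 d2] := partials_swap (dXu i) Dp; split.
    by apply: (is_derive_eq d1); rewrite /= [X in X / _]addrC.
  by apply: (is_derive_eq d2); rewrite /= mulNr.
Qed.

Lemma frame_tangent_I3 D c (X Xu Xv : R * R -> 'cV[R]_4) (E f g fu fv gu gv : R * R -> R) :
  frame D c X Xu Xv E f g fu fv gu gv ->
  forall p, D p -> Xu p 3%:R 0 = Xu p 0 0 /\ Xv p 3%:R 0 = Xv p 0 0.
Proof.
move=> F p Dp.
exact: (partials_eq (frame_open F) (frame_I3 F) (frame_dX F 3%:R) (frame_dX F 0) Dp).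
Qed.

Lemma constant_slice_derive (F : R * R -> R) (p : R * R) (e k d u : R) :
  (forall s, `|s - p.1| < e -> F (s, p.2) = k) -> `|u - p.1| < e ->
  is_derive (u, p.2) (eu R) F d -> d = 0.
Proof.
move=> Fk hu /is_derive_fst dF; apply: (is_derive_uniq dF).
have : is_derive u 1 (fun=> k) (0 : R) by exact: derv_cst.
apply: near_eq_is_derive; apply/nbhs_ballP; exists (e - `|u - p.1|) => /=.
  by rewrite subr_gt0.
move=> s hs; rewrite Fk //.
have -> : s - p.1 = (s - u) + (u - p.1) by rewrite addrA subrK.
by rewrite (le_lt_trans (ler_normD _ _)) // -ltrBrDr distrC.
Qed.

(** Without its last row the direction matrix is 3 by 2, so it has a non-zero left kernel vector, a
    covector in the coordinates (l, x, y). *)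
Lemma affine_plane_covector (P : set 'cV[R]_4) : affine_plane P ->
  exists n0 n1 n2 k : R, ~ (n0 = 0 /\ n1 = 0 /\ n2 = 0) /\
    forall Y, P Y -> n0 * Y 0 0 + n1 * Y 1 0 + n2 * Y 2%:R 0 = k.
Proof.
move=> [Y0 [W [_ _ _ ->]]].
pose W' : 'M[R]_(3, 2) := \matrix_(i < 3, j < 2) W (lift ord_max i) j.
pose v := nz_row (kermx W').
have v0 : v != 0.
  rewrite nz_row_eq0 -mxrank_eq0 mxrank_ker subn_eq0 -ltnNge.
  exact: leq_ltn_trans (rank_leq_col _) _.
have vW : v *m W' = 0 by apply/sub_kermxP; exact: nz_row_sub.
have vWj (j : 'I_2) : v 0 0 * W 0 j + v 0 1 * W 1 j + v 0 2%:R * W 2%:R j = 0.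
  have := congr1 (fun M : 'M[R]_(1, 2) => M 0 j) vW.
  rewrite !mxE !big_ord_recl big_ord0 !mxE addr0 addrA.
  rewrite (_ : lift ord0 ord0 = 1); last exact/val_inj.
  rewrite (_ : lift ord0 (lift ord0 ord0) = 2%:R); last exact/val_inj.
  rewrite (_ : lift ord_max ord0 = 0); last exact/val_inj.
  rewrite (_ : lift ord_max 1 = 1); last exact/val_inj.
  by rewrite (_ : lift ord_max 2%:R = 2%:R); last exact/val_inj.
exists (v 0 0), (v 0 1), (v 0 2%:R),
  (v 0 0 * Y0 0 0 + v 0 1 * Y0 1 0 + v 0 2%:R * Y0 2%:R 0); split.
  move=> [h0 [h1 h2]]; move/eqP: v0; apply; apply/rowP => -[[|[|[|//]]] Hi]; rewrite mxE.
  - by rewrite -[RHS]h0; congr (v _ _); exact/val_inj.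
  - by rewrite -[RHS]h1; congr (v _ _); exact/val_inj.
  - by rewrite -[RHS]h2; congr (v _ _); exact/val_inj.
move=> _ [c _ <-].
have aE i : (Y0 + W *m c) i 0 = Y0 i 0 + (W i 0 * c 0 0 + W i 1 * c 1 0).
  rewrite mxE [X in _ + X]mxE !big_ord_recl big_ord0 addr0.
  by rewrite (_ : lift ord0 ord0 = 1); last exact/val_inj.
rewrite !aE.
lincomb ((v 0 0 * W 0 0 + v 0 1 * W 1 0 + v 0 2%:R * W 2%:R 0) * c 0 0 +
  (v 0 0 * W 0 1 + v 0 1 * W 1 1 + v 0 2%:R * W 2%:R 1) * c 1 0).
by rewrite !vWj; ring.
Qed.

Lemma slice_ball (D : set (R * R)) (p : R * R) (e : R) : 0 < e ->
  (forall s, `|s - p.1| < e -> D (s, p.2)) ->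
  forall s, `|s - p.1| < e ->
    connected_component [set u | D (u, p.2)] p.1 s.
Proof.
move=> e0 De s hs.
apply: (@connected_component_max _ _ [set u | `|u - p.1| < e]) => //=.
- by rewrite subrr normr0.
- apply/connected_intervalP => x y /= hx hy z /andP[xz zy].
  by apply: (dist_between hx hy); rewrite xz zy.
Qed.

Lemma covector_alg (n0 n1 n2 a0 a1 a2 b0 b1 b2 c e f g : R) : e != 0 ->
  n0 * ((f * a0 - g * b0) / e - c * 1) + n1 * ((f * a1 - g * b1) / e - c * 0) +
    n2 * ((f * a2 - g * b2) / e - c * 0) = 0 ->
  n0 * a0 + n1 * a1 + n2 * a2 = 0 ->
  g * (n0 * b0 + n1 * b1 + n2 * b2) + c * n0 * e = 0.
Proof.
move=> e0 h1 h2; transitivity (f * (n0 * a0 + n1 * a1 + n2 * a2) -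
  e * (n0 * ((f * a0 - g * b0) / e - c * 1) + n1 * ((f * a1 - g * b1) / e - c * 0) +
    n2 * ((f * a2 - g * b2) / e - c * 0))); first by field.
by rewrite h1 h2; ring.
Qed.

(** The u-derivative of the relation found in [covector_alg]: modulo n(X_u) = 0 and that relation,
    only the term with g' = g_u survives. *)
Lemma covector_derivative_alg (n0 n1 n2 a0 a1 a2 b0 b1 b2 c e f g g' : R) : e != 0 ->
  g' * (n0 * b0 + n1 * b1 + n2 * b2) + g * (n0 * ((g * a0 + f * b0) / e) +
    n1 * ((g * a1 + f * b1) / e) + n2 * ((g * a2 + f * b2) / e)) +
    (0 * e + c * n0 * f) = 0 ->
  n0 * a0 + n1 * a1 + n2 * a2 = 0 ->
  g * (n0 * b0 + n1 * b1 + n2 * b2) + c * n0 * e = 0 ->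
  g' * (n0 * b0 + n1 * b1 + n2 * b2) = 0.
Proof.
move=> e0 h1 h2 h3.
transitivity (g' * (n0 * b0 + n1 * b1 + n2 * b2) + g * (n0 * ((g * a0 + f * b0) / e) +
    n1 * ((g * a1 + f * b1) / e) + n2 * ((g * a2 + f * b2) / e)) +
    (0 * e + c * n0 * f) - g * g / e * (n0 * a0 + n1 * a1 + n2 * a2) -
    f / e * (g * (n0 * b0 + n1 * b1 + n2 * b2) + c * n0 * e)); first by field.
by rewrite h1 h2 h3; ring.
Qed.

(** A covector n constant on the line kills X_u and X_uu, and one more derivative leaves g_u n(X_v)
    = 0. If n(X_v) = 0, then g n(X_v) + c n0 E = 0 forces n0 = 0, and n kills the horizontal parts
    of X_u and X_v, so n = 0. *)
Lemma planar_u_lines D c (X Xu Xv : R * R -> 'cV[R]_4)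
    (E f g fu fv gu gv : R * R -> R) p :
  frame D c X Xu Xv E f g fu fv gu gv -> D p ->
  (exists2 P, affine_plane P & u_line D X p `<=` P) -> gu p = 0.
Proof.
move=> F Dp [P /affine_plane_covector[n0 [n1 [n2 [k [nz Pk]]]]] UP].
have [oD _ c1 E0 dE _ dg _ _ _ uu vv uv dX dXu dXv] := F.
have [p0 p1 p2 _] := @ppE R.
have En : E p != 0 by rewrite gt_eqF // E0.
have cn : c != 0 by rewrite -sqrf_eq0 c1 oner_neq0.
have nD : nbhs p D by exact: open_nbhs_nbhs.
have [e e0 He] := nbhs_box nD.
have De s : `|s - p.1| < e -> D (s, p.2).
  by move=> hs; apply: He; rewrite // subrr normr0.
pose lin (Y : R * R -> 'cV[R]_4) q := n0 * Y q 0 0 + n1 * Y q 1 0 + n2 * Y q 2%:R 0.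
have lk s : `|s - p.1| < e -> lin X (s, p.2) = k.
  by move=> hs; apply: Pk; apply: UP; exists s => //; exact: slice_ball hs.
have dlin (Y : R * R -> 'cV[R]_4) q v d0 d1 d2 : is_derive q v (fun x => Y x 0 0) d0 ->
    is_derive q v (fun x => Y x 1 0) d1 -> is_derive q v (fun x => Y x 2%:R 0) d2 ->
    is_derive q v (lin Y) (n0 * d0 + n1 * d1 + n2 * d2).
  move=> h0 h1 h2.
  apply: (is_derive_eq (derv_add (derv_add (derv_mul (derv_cst q v n0) h0)
    (derv_mul (derv_cst q v n1) h1)) (derv_mul (derv_cst q v n2) h2))).
  by rewrite /=; ring.
have lu s : `|s - p.1| < e -> lin Xu (s, p.2) = 0.
  move=> hs; have Ds := De s hs; apply: (constant_slice_derive lk hs).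
  exact: (dlin X _ _ _ _ _ (dX 0 _ Ds).1 (dX 1 _ Ds).1 (dX 2%:R _ Ds).1).
pose G q := g q * lin Xv q + c * n0 * E q.
have luu s : `|s - p.1| < e -> G (s, p.2) = 0.
  move=> hs; have Ds := De s hs.
  have := constant_slice_derive lu hs
    (dlin Xu _ _ _ _ _ (dXu 0 _ Ds).1 (dXu 1 _ Ds).1 (dXu 2%:R _ Ds).1).
  rewrite p0 p1 p2 /= => h.
  have En' : E (s, p.2) != 0 by rewrite gt_eqF // E0.
  exact: (covector_alg En' h (lu s hs)).
have [pu pv] : (p.1, p.2) = p /\ `|p.1 - p.1| < e.
  by rewrite -surjective_pairing subrr normr0.
have dp := De _ pv.
have dGu := constant_slice_derive luu pv (derv_add
   (derv_mul (dg _ dp).1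
     (dlin Xv _ _ _ _ _ (dXv 0 _ dp).1 (dXv 1 _ dp).1 (dXv 2%:R _ dp).1))
   (derv_mul (derv_cst _ _ (c * n0)) (dE _ dp).1)).
have lu0 := lu _ pv; have lg0 := luu _ pv.
rewrite pu /= in dGu lu0 lg0.
have key : gu p * lin Xv p = 0.
  exact: (covector_derivative_alg En dGu lu0 lg0).
move/eqP: key; rewrite mulf_eq0 => /orP[/eqP //|/eqP lv0].
exfalso; apply: nz.
have n00 : n0 = 0.
  move: lg0; rewrite /G lv0 mulr0 add0r => /eqP.
  by rewrite !mulf_eq0 (negPf cn) (negPf En) orbF /= => /eqP.
rewrite /lin n00 !mul0r !add0r in lu0 lv0.
have [-> ->] : n1 = (0 * Xu p 1 0 + 0 * Xv p 1 0) / E p /\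
    n2 = (0 * Xu p 2%:R 0 + 0 * Xv p 2%:R 0) / E p.
  by apply: (frame_expand En (uu p Dp) (vv p Dp) (uv p Dp)); rewrite mulr0.
by rewrite !mul0r addr0 mul0r.
Qed.

(** When g_u = 0, the covector that kills X_u and X_uu can be scaled to be constant along the
    line. *)
Lemma u_lines_planar D c (X Xu Xv : R * R -> 'cV[R]_4)
    (E f g fu fv gu gv : R * R -> R) p :
  frame D c X Xu Xv E f g fu fv gu gv -> (forall q, D q -> gu q = 0) -> D p ->
  exists2 P, affine_plane P & u_line D X p `<=` P.
Proof.
move=> F gu0 Dp.
have [oD _ c1 E0 dE _ dg _ _ X3 uu vv uv dX dXu dXv] := F.
have [p0 p1 p2 p3] := @ppE R.
have En q : D q -> E q != 0 by move=> Dq; rewrite gt_eqF // E0.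
have cn : c != 0 by rewrite -sqrf_eq0 c1 oner_neq0.
(* The covector of the plane: g times the lightlike normal minus c Xv / E. *)
pose nn i q := - (Xu q 0 0 * Xu q i 0 + Xv q 0 0 * Xv q i 0) / (E q * E q).
pose nu i q := g q * nn i q - c * Xv q i 0 / E q.
(* [nu] gives the x- and y-components, where p vanishes; the l-component is g itself, constant
   because g_u = 0. *)
have dnu i q : pp R i 0 = 0 -> D q -> is_derive q (eu R) (nu i) 0.
  move=> pi Dq; have [dx0 _] := dXu 0 q Dq; have [dxi _] := dXu i q Dq.
  have [dy0 _] := dXv 0 q Dq; have [dyi _] := dXv i q Dq.
  have [de _] := dE q Dq; have [dg' _] := dg q Dq; have e0 := En q Dq.
  have e2 : E q * E q != 0 by rewrite mulf_neq0.
  have D1 := derv_mul (derv_opp (derv_add (derv_mul dx0 dxi) (derv_mul dy0 dyi)))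
    (derv_inv (F := fun x => E x * E x) e2 (derv_mul de de)).
  have D2 := derv_mul (derv_mul (derv_cst q (eu R) c) dyi) (derv_inv e0 de).
  have D3 : is_derive q (eu R) (nu i) _ := derv_add (derv_mul dg' D1) (derv_opp D2).
  apply: (is_derive_eq D3).
  by rewrite gu0 // pi p0 /=; field.
have nuXu q : D q -> g q * Xu q 0 0 + nu 1 q * Xu q 1 0 + nu 2%:R q * Xu q 2%:R 0 = 0.
  move=> Dq; have e0 := En q Dq; rewrite /nu /nn.
  transitivity (g q * Xu q 0 0 * (E q ^+ 2 - (Xu q 1 0 ^+ 2 + Xu q 2%:R 0 ^+ 2)) / E q ^+ 2
    - (g q * Xv q 0 0 / E q ^+ 2 + c / E q) *
      (Xu q 1 0 * Xv q 1 0 + Xu q 2%:R 0 * Xv q 2%:R 0)); first by field.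
  by rewrite uu // uv // subrr !(mulr0, mul0r) subr0.
pose C := connected_component [set u | D (u, p.2)] p.1.
have DC s : C s -> D (s, p.2) by exact: connected_component_sub.
have Cp : C p.1 by apply: connected_component_refl; rewrite /= -surjective_pairing.
have Cbt s x : C s -> (p.1 <= x <= s) || (s <= x <= p.1) -> C x.
  move=> Cs; have /connected_intervalP iC : connected C by exact: component_connected.
  by move=> /orP[] xs; [apply: (iC p.1 s)|apply: (iC s p.1)].
have slice_cst (F0 : R * R -> R) : (forall s, C s -> is_derive (s, p.2) (eu R) F0 0) ->
    forall s, C s -> F0 (s, p.2) = F0 p.
  move=> dF s Cs.
  have -> : F0 p = F0 (p.1, p.2) by rewrite -surjective_pairing.
  apply/esym/(@zero_derive_eq _ (fun x => F0 (x, p.2))) => x bx.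
  by apply: is_derive_fst; apply: dF; exact: Cbt bx.
have gC s : C s -> g (s, p.2) = g p.
  by apply: slice_cst => x /DC Dx; have [] := dg _ Dx; rewrite gu0.
have nuC i s : pp R i 0 = 0 -> C s -> nu i (s, p.2) = nu i p.
  by move=> pi; apply: slice_cst => x /DC Dx; exact: dnu.
pose h q := g p * X q 0 0 + nu 1 p * X q 1 0 + nu 2%:R p * X q 2%:R 0.
have hC s : C s -> h (s, p.2) = h p.
  apply: slice_cst => x Cx; have Dx := DC _ Cx.
  apply: (is_derive_eq (derv_add (derv_add
    (derv_mul (derv_cst _ _ (g p)) (dX 0 _ Dx).1)
    (derv_mul (derv_cst _ _ (nu 1 p)) (dX 1 _ Dx).1))
    (derv_mul (derv_cst _ _ (nu 2%:R p)) (dX 2%:R _ Dx).1))).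
  have := nuXu _ Dx; rewrite gC // (nuC 1) // (nuC 2%:R) // => h0.
  by rewrite -[RHS]h0 /=; ring.
have ep := En p Dp.
have [xu3 xv3] := frame_tangent_I3 F Dp.
(* The second column is f X_u - E X_uu; its term c E p keeps the rank equal to 2 even where g =
   0. *)
pose W : 'M[R]_(4, 2) :=
  \matrix_(i, j) if j == 0 then Xu p i 0 else g p * Xv p i 0 + c * E p * pp R i 0.
have Wc (x : 'cV[R]_2) i : (W *m x) i 0 =
    Xu p i 0 * x 0 0 + (g p * Xv p i 0 + c * E p * pp R i 0) * x 1 0.
  rewrite !mxE !big_ord_recl big_ord0 addr0 !mxE /=.
  by rewrite (_ : lift ord0 ord0 = 1) //; exact/val_inj.
have W3 x : I3 (W *m x) by apply/I3P; rewrite !Wc p0 p3 xu3 xv3.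
exists [set X p + W *m x | x in [set: 'cV[R]_2]].
  exists (X p), W; split=> //; first by apply/I3P; exact: X3.
  apply/eqP/row_fullP.
  (* A left inverse of [W], up to scaling of the rows: the product with the horizontal part of X_u,
     and the lightlike normal, which kills X_u and X_v and is 1 on p. *)
  pose B : 'M[R]_(2, 4) := \matrix_(i, j) if i == 0
    then [:: 0; Xu p 1 0; Xu p 2%:R 0; 0]`_j / E p ^+ 2
    else [:: 1; nn 1 p; nn 2%:R p; 0]`_j / (c * E p).
  exists B; apply/matrixP => i j; rewrite !mxE !big_ord_recl big_ord0 !mxE /=.
  rewrite (_ : lift ord0 ord0 = 1); last exact/val_inj.
  rewrite (_ : lift ord0 (lift ord0 ord0) = 2%:R); last exact/val_inj.
  rewrite /nn; have := uu p Dp; have := vv p Dp; have := uv p Dp.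
  set a1 := Xu p 1 0; set a2 := Xu p 2%:R 0; set b1 := Xv p 1 0; set b2 := Xv p 2%:R 0.
  move=> h3 h2 h1; have ce : (c != 0) && (E p != 0) by rewrite cn ep.
  case: i => -[|[|//]] Hi; case: j => -[|[|//]] Hj /=.
  - by transitivity ((a1 ^+ 2 + a2 ^+ 2) / E p ^+ 2); [field|rewrite h1 divff ?expf_neq0].
  - by transitivity (g p * (a1 * b1 + a2 * b2) / E p ^+ 2); [field|rewrite h3 mulr0 mul0r].
  - transitivity ((Xu p 0 0 * (E p ^+ 2 - (a1 ^+ 2 + a2 ^+ 2))
      - Xv p 0 0 * (a1 * b1 + a2 * b2)) / (c * E p ^+ 3)); first by field; rewrite cn ep.
    by rewrite h1 h3 subrr !mulr0 subr0 mul0r.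
  - transitivity (1 + g p * (Xv p 0 0 * (E p ^+ 2 - (b1 ^+ 2 + b2 ^+ 2))
      - Xu p 0 0 * (a1 * b1 + a2 * b2)) / (c * E p ^+ 3)); first by field; rewrite cn ep.
    by rewrite h2 h3 subrr !mulr0 subr0 mulr0 mul0r addr0.
move=> _ [s Cs <-].
have := hC s Cs; rewrite /h /nu.
have [d1 d2 d12] := frame_dual ep (uu p Dp) (vv p Dp) (uv p Dp).
(* The displacement from [X p], and then [d], its pairing with the lightlike normal. The coordinates
   [x] are the left inverse applied to the displacement; the plane equation [gd] fixes its
   X_v-component. *)
pose dl i := X (s, p.2) i 0 - X p i 0.
pose d := dl 0 + nn 1 p * dl 1 + nn 2%:R p * dl 2%:R.
move=> hs; have gd : g p * d = c * (Xv p 1 0 * dl 1 + Xv p 2%:R 0 * dl 2%:R) / E p.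
  apply/eqP; rewrite -subr_eq0; move/eqP: hs; rewrite -subr_eq0.
  by congr (_ == _); rewrite /d /dl; field.
pose x : 'cV[R]_2 := \col_j if j == 0
  then (Xu p 1 0 * dl 1 + Xu p 2%:R 0 * dl 2%:R) / E p ^+ 2 else d / (c * E p).
have x0 : x 0 0 = (Xu p 1 0 * dl 1 + Xu p 2%:R 0 * dl 2%:R) / E p ^+ 2 by rewrite mxE.
have x1 : x 1 0 = d / (c * E p) by rewrite mxE.
exists x => //; apply/colP => i; rewrite mxE Wc x0 x1.
have -> : X (s, p.2) i 0 = X p i 0 + dl i by rewrite /dl addrC subrK.
congr (_ + _).
transitivity (Xu p i 0 * (Xu p 1 0 * dl 1 + Xu p 2%:R 0 * dl 2%:R) / E p ^+ 2
  + Xv p i 0 * (g p * d) / (c * E p) + pp R i 0 * d); first by field; rewrite ep cn.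
rewrite gd; elim/ord4P: i.
- by rewrite p0 /d /nn; field; rewrite ep cn.
- rewrite p1; transitivity (((Xu p 1 0 ^+ 2 + Xv p 1 0 ^+ 2) * dl 1
    + (Xu p 1 0 * Xu p 2%:R 0 + Xv p 1 0 * Xv p 2%:R 0) * dl 2%:R) / E p ^+ 2).
    by field; rewrite ep cn.
  by rewrite d1 d12; field.
- rewrite p2; transitivity (((Xu p 2%:R 0 ^+ 2 + Xv p 2%:R 0 ^+ 2) * dl 2%:R
    + (Xu p 1 0 * Xu p 2%:R 0 + Xv p 1 0 * Xv p 2%:R 0) * dl 1) / E p ^+ 2).
    by field; rewrite ep cn.
  by rewrite d2 d12; field.
- have -> : dl 3%:R = dl 0 by rewrite /dl !X3 //; exact: DC.
  by rewrite p3 xu3 xv3 /d /nn; field; rewrite ep cn.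
Qed.

(** Interchanging u and v turns v-lines into u-lines and g_u into f_v, the same function, so one
    condition governs both families. *)
Lemma planar_iff D c (X Xu Xv : R * R -> 'cV[R]_4) (E f g fu fv gu gv : R * R -> R) :
  frame D c X Xu Xv E f g fu fv gu gv ->
  planar_curvature_lines D X <-> (forall p, D p -> gu p = 0).
Proof.
move=> F; split=> [pl p Dp|gu0 p Dp].
  by have [hu _] := pl p Dp; exact: planar_u_lines F Dp hu.
split; first exact: u_lines_planar F gu0 Dp.
apply: (@u_lines_planar _ _ _ _ _ _ _ _ _ _ _ _ (swap p) (frame_swap F)).
- by move=> q Dq; rewrite /= (frame_sym F) //; exact: gu0.
- by rewrite /preimage /= swapK.
Qed.

End Planarity.

(** * The frame equations under changes of coordinates *)

Section FrameTransport.
Variable R : realType.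

Definition reflect_u (p : R * R) : R * R := (- p.1, p.2).

Lemma reflect_uK : cancel reflect_u reflect_u.
Proof. by case=> u v; rewrite /reflect_u /= opprK. Qed.

Lemma reflect_u_continuous : continuous reflect_u.
Proof.
apply: pair_continuous; last exact: snd_continuous.
by move=> p; apply: continuousN; exact: fst_continuous.
Qed.

Lemma partials_reflect D (F Fu Fv : R * R -> R) : partials D F Fu Fv ->
  partials (reflect_u @^-1` D) (F \o reflect_u)
    (fun p => - Fu (reflect_u p)) (Fv \o reflect_u).
Proof.
move=> dF p Dp; have [du dv] := dF _ Dp; split.
  apply: (is_derive_reparam _ (derv_oppdir du)) => h.
  rewrite /reflect_u scalerN; congr pair; rewrite /= ?opprD //.
  by rewrite dirE scaler0 oppr0.
apply: (is_derive_reparam _ dv) => h.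
rewrite /reflect_u; congr pair; rewrite /= dirE.
by rewrite scaler0 !add0r.
Qed.

(** Each quantity changes sign once for every u-derivative in it; [c] stays, since X_uu and X_vv are
    even. *)
Lemma frame_reflect D c (X Xu Xv : R * R -> 'cV[R]_4) (E f g fu fv gu gv : R * R -> R) :
  frame D c X Xu Xv E f g fu fv gu gv ->
  frame (reflect_u @^-1` D) c (X \o reflect_u) (fun p => - Xu (reflect_u p))
    (Xv \o reflect_u) (E \o reflect_u) (fun p => - f (reflect_u p)) (g \o reflect_u)
    (fu \o reflect_u) (fun p => - fv (reflect_u p))
    (fun p => - gu (reflect_u p)) (gv \o reflect_u).
Proof.
case=> oD cD c1 E0 dE df dg sy hE X3 uu vv uv dX dXu dXv.
have en i p : (- Xu p) i 0 = - Xu p i 0 by rewrite mxE.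
split=> //.
- by have /continuousP := reflect_u_continuous; exact.
- exact (connected_preimage reflect_uK reflect_uK reflect_u_continuous cD).
- by move=> p Dp; exact: E0.
- exact: (partials_reflect dE).
- move=> p Dp; have [d1 d2] := partials_reflect df Dp.
  by split; [apply: (is_derive_eq (derv_opp d1)); rewrite opprK|exact: (derv_opp d2)].
- exact: (partials_reflect dg).
- by move=> p Dp; rewrite sy.
- by move=> p Dp; rewrite /= hE // sqrrN.
- by move=> p Dp; exact: X3.
- by move=> p Dp; rewrite !en !sqrrN; exact: uu.
- by move=> p Dp; exact: vv.
- by move=> p Dp; rewrite !en !mulNr -opprD uv ?oppr0.
- move=> i p Dp; have [d1 d2] := partials_reflect (dX i) Dp.
  by split; [apply: (is_derive_eq d1); rewrite en|exact: d2].
- move=> i p Dp; have [d1 d2] := partials_reflect (dXu i) Dp.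
  have -> : (fun p => (- Xu (reflect_u p)) i 0) =
     (fun p => - ((fun p => Xu p i 0) \o reflect_u) p) by apply/funext => q; rewrite en.
  rewrite en; split.
    by apply: (is_derive_eq (derv_opp d1)); rewrite opprK mulrNN.
  apply: (is_derive_eq (derv_opp d2)); rewrite /= -mulNr; congr (_ / _); ring.
- move=> i p Dp; have [d1 d2] := partials_reflect (dXv i) Dp.
  rewrite en; split.
    apply: (is_derive_eq d1); rewrite /= -mulNr; congr (_ / _); ring.
  by apply: (is_derive_eq d2); rewrite /= mulrNN.
Qed.

Definition translate (a b : R) (p : R * R) : R * R := (p.1 + a, p.2 + b).

Lemma translate_continuous a b : continuous (translate a b).
Proof.
by apply: pair_continuous => p; apply: continuousD; try exact: cvg_cst;
  [exact: fst_continuous|exact: snd_continuous].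
Qed.

Lemma partials_translate D (F Fu Fv : R * R -> R) a b : partials D F Fu Fv ->
  partials (translate a b @^-1` D) (F \o translate a b)
    (Fu \o translate a b) (Fv \o translate a b).
Proof.
move=> dF p Dp; have [du dv] := dF _ Dp.
by split; [apply: (is_derive_reparam _ du)|apply: (is_derive_reparam _ dv)] => h;
  rewrite /translate; congr pair; rewrite /= addrA.
Qed.

Lemma frame_translate D c (X Xu Xv : R * R -> 'cV[R]_4)
    (E f g fu fv gu gv : R * R -> R) a b :
  frame D c X Xu Xv E f g fu fv gu gv ->
  let t := translate a b in
  frame (t @^-1` D) c (X \o t) (Xu \o t) (Xv \o t) (E \o t) (f \o t) (g \o t)
    (fu \o t) (fv \o t) (gu \o t) (gv \o t).
Proof.
case=> oD cD c1 E0 dE df dg sy hE X3 uu vv uv dX dXu dXv.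
split=> //.
- by have /continuousP := translate_continuous (a := a) (b := b); exact.
- apply: (@connected_preimage _ _ (translate (- a) (- b))) => //.
  + by case=> u v; rewrite /translate /= !addrK.
  + by case=> u v; rewrite /translate /= !subrK.
  + exact: translate_continuous.
- by move=> p; exact: E0.
- exact: (partials_translate dE).
- exact: (partials_translate df).
- exact: (partials_translate dg).
- by move=> p; exact: sy.
- by move=> p; exact: hE.
- by move=> p; exact: X3.
- by move=> p; exact: uu.
- by move=> p; exact: vv.
- by move=> p; exact: uv.
- by move=> i; exact: (partials_translate (dX i)).
- by move=> i; exact: (partials_translate (dXu i)).
- by move=> i; exact: (partials_translate (dXv i)).
Qed.

(* Z records where the mixed derivative of E vanishes, a condition that does not
   depend on the choice of coordinates. *)
Definition framed (D : set (R * R)) (X : R * R -> 'cV[R]_4) (E : R * R -> R)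
    (Z : set (R * R)) : Prop :=
  exists c Xu Xv f g fu fv gu gv, frame D c X Xu Xv E f g fu fv gu gv /\
    forall p, D p -> (gu p = 0 <-> Z p).

Lemma framed_coord_change D X E Z (phi : R * R -> R * R) : coord_change phi ->
  framed D X E Z -> framed (phi @^-1` D) (X \o phi) (E \o phi) (phi @^-1` Z).
Proof.
have sw D' X' E' Z' : framed D' X' E' Z' ->
    framed (@swap R @^-1` D') (X' \o @swap R) (E' \o @swap R) (@swap R @^-1` Z').
  move=> [c [Xu [Xv [f [g [fu [fv [gu [gv [F HZ]]]]]]]]]].
  do 9 eexists; split; first exact: frame_swap F.
  by move=> p Dp /=; rewrite (frame_sym F Dp); exact: HZ.
have re D' X' E' Z' : framed D' X' E' Z' ->
    framed (reflect_u @^-1` D') (X' \o reflect_u) (E' \o reflect_u) (reflect_u @^-1` Z').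
  move=> [c [Xu [Xv [f [g [fu [fv [gu [gv [F HZ]]]]]]]]]].
  do 9 eexists; split; first exact: frame_reflect F.
  move=> p Dp /=; split=> [h|/(HZ _ Dp).2 ->]; last by rewrite oppr0.
  by apply: (HZ _ Dp).1; rewrite -[LHS]opprK h oppr0.
move=> + F; elim=> {phi} [//|u0 v0 phi _|phi _|phi _|phi _].
- move=> [c [Xu [Xv [f [g [fu [fv [gu [gv [F' HZ]]]]]]]]]].
  do 9 eexists; split; first exact: (frame_translate u0 v0 F').
  by move=> p Dp; exact: HZ.
- exact: re.
(* The reflection v -> -v is the reflection of u conjugated by the interchange. *)
- by move=> F'; exact: (sw _ _ _ _ (re _ _ _ _ (sw _ _ _ _ F'))).
- exact: sw.
Qed.

Lemma frame_f_of D c (X Xu Xv : R * R -> 'cV[R]_4) (omega f g fu fv gu gv : R * R -> R) :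
  frame D c X Xu Xv (fun p => expR (omega p)) f g fu fv gu gv ->
  forall p, D p -> f_of omega p = f p /\ g_of omega p = g p.
Proof.
move=> F p Dp; have [du dv] := frame_dE F Dp.
by split; apply: (@derive_exp_comp _ omega id) => //.
Qed.

End FrameTransport.

(** * Closed forms and surfaces of revolution *)

Section ClosedFormsOfCases.
Variable R : realType.

Lemma derv_sinh (F : R * R -> R) p v d : is_derive p v F d ->
  is_derive p v (fun q => sinh (F q)) (cosh (F p) * d).
Proof.
move=> dF; apply: (is_derive_eq (derv_mul
  (derv_add (derv_exp dF) (derv_opp (derv_exp (derv_opp dF)))) (derv_cst _ _ 2^-1))).
by rewrite /cosh /=; field.
Qed.

Lemma derv_cosh (F : R * R -> R) p v d : is_derive p v F d ->
  is_derive p v (fun q => cosh (F q)) (sinh (F p) * d).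
Proof.
move=> dF; apply: (is_derive_eq (derv_mul
  (derv_add (derv_exp dF) (derv_exp (derv_opp dF))) (derv_cst _ _ 2^-1))).
by rewrite /sinh /=; field.
Qed.

Lemma cosh2_sinh2 (x : R) : cosh x ^+ 2 - sinh x ^+ 2 = 1.
Proof.
have e : expR (- x) * expR x = 1 by rewrite -expRD addNr expR0.
by rewrite /cosh /sinh -[RHS]e; field.
Qed.

Lemma cosh_gt1 (x : R) : x != 0 -> 1 < cosh x.
Proof.
move=> x0.
have e : expR (- x) * expR x = 1 by rewrite -expRD addNr expR0.
have ne : expR x != expR (- x).
  apply/eqP => /expR_inj h; move/eqP: x0; apply; lra.
rewrite -subr_gt0 /cosh.
(* This is cosh x - 1 = sinh^2 x / (cosh x + 1); the last term, which vanishes, makes it a rational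
   identity in two independent variables. *)
have -> : (expR x + expR (- x)) / 2 - 1 =
  ((expR x - expR (- x)) ^+ 2 / (2 * (expR x + expR (- x) + 2))) +
  2 * (expR (- x) * expR x - 1) / (expR x + expR (- x) + 2).
  have h1 := expR_gt0 x; have h2 := expR_gt0 (- x).
  by field; rewrite gt_eqF //; lra.
rewrite e subrr mulr0 mul0r addr0 divr_gt0 //.
by rewrite exprn_even_gt0 //= subr_eq0.
Qed.

Section ClosedForms.
Variables (D : set (R * R)) (c : R) (X Xu Xv : R * R -> 'cV[R]_4).
Variables (omega f g fu fv gu gv : R * R -> R).
Hypothesis F : frame D c X Xu Xv (fun p => expR (omega p)) f g fu fv gu gv.

Lemma frame_fu (F0 : R * R -> R) p d : D p ->
  (forall q, D q -> f_of omega q = F0 q) -> is_derive p (eu R) F0 d -> fu p = d.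
Proof.
move=> Dp fF0; apply: (is_derive_open_eq (frame_open F) Dp) (frame_df F Dp).1.
by move=> q Dq; rewrite -fF0 // (frame_f_of F Dq).1.
Qed.

Lemma frame_gv (F0 : R * R -> R) p d : D p ->
  (forall q, D q -> g_of omega q = F0 q) -> is_derive p (ev R) F0 d -> gv p = d.
Proof.
move=> Dp fF0; apply: (is_derive_open_eq (frame_open F) Dp) (frame_dg F Dp).2.
by move=> q Dq; rewrite -fF0 // (frame_f_of F Dq).2.
Qed.

Lemma frame_gu (F0 : R * R -> R) p d : D p ->
  (forall q, D q -> g_of omega q = F0 q) -> is_derive p (eu R) F0 d -> gu p = d.
Proof.
move=> Dp fF0; apply: (is_derive_open_eq (frame_open F) Dp) (frame_dg F Dp).1.
by move=> q Dq; rewrite -fF0 // (frame_f_of F Dq).2.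
Qed.

(** The harmonic equation E (f_u + g_v) = f^2 + g^2 determines E algebraically, so no constant of
    integration is left. *)
Lemma closed_form_1a a : 0 < a -> case1a D omega a ->
  forall p, D p -> expR (omega p) = exp_w1a a p.
Proof.
move=> a0 h p Dp; have [fp gp] := frame_f_of F Dp; have [hf hg] := h p Dp.
have e0 := expR_gt0 (- (a * p.1)).
have fup : fu p = a * expR (- (a * p.1)).
  apply: (frame_fu (F0 := fun q => - expR (- (a * q.1))) Dp (fun q Dq => (h q Dq).1)).
  apply: (is_derive_eq (derv_opp (derv_exp (derv_opp
    (derv_mul (derv_cst _ _ a) (derv_fst _ _)))))).
  by rewrite dirE /=; ring.
have gvp : gv p = 0.
  exact: (frame_gv (F0 := fun=> 0) Dp (fun q Dq => (h q Dq).2) (derv_cst _ _ _)).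
have := frame_harm F Dp; rewrite -fp -gp hf hg fup gvp addr0 expr0n addr0 sqrrN /exp_w1a.
move=> hh; apply: (mulIf (_ : a * expR (- (a * p.1)) != 0)).
  by rewrite mulf_neq0 // gt_eqF.
by rewrite hh; field; rewrite gt_eqF.
Qed.

Lemma closed_form_1b b : 0 < b -> case1b D omega b ->
  forall p, D p -> expR (omega p) = exp_w1b b p.
Proof.
move=> b0 h p Dp; have [fp gp] := frame_f_of F Dp; have [hf hg] := h p Dp.
have fup : fu p = b.
  apply: (frame_fu (F0 := fun q => b * q.1) Dp (fun q Dq => (h q Dq).1)).
  apply: (is_derive_eq (derv_mul (derv_cst _ _ b) (derv_fst _ _))).
  by rewrite dirE /=; ring.
have gvp : gv p = b.
  apply: (frame_gv (F0 := fun q => b * q.2) Dp (fun q Dq => (h q Dq).2)).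
  apply: (is_derive_eq (derv_mul (derv_cst _ _ b) (derv_snd _ _))).
  by rewrite dirE /=; ring.
have := frame_harm F Dp; rewrite -fp -gp hf hg fup gvp /exp_w1b.
move=> hh; apply: (mulIf (_ : b + b != 0)); first by rewrite gt_eqF // addr_gt0.
by rewrite hh; field.
Qed.

(** Here f_u + g_v = b (cosh a u + cos a v) can vanish on u = 0, so the harmonic equation is used
    off that line only. The difference between E and the closed form has zero gradient, and the open
    set [D] has a point with u != 0. *)
Lemma closed_form_1c a b : 0 < a -> 0 < b -> case1c D omega a b ->
  forall p, D p -> expR (omega p) = exp_w1c a b p.
Proof.
move=> a0 b0 h p Dp.
have an : a != 0 by rewrite gt_eqF.
have bn : b != 0 by rewrite gt_eqF.
have dau q v := derv_mul (derv_cst q v a) (derv_fst q v).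
have dav q v := derv_mul (derv_cst q v a) (derv_snd q v).
have off q : D q -> q.1 != 0 -> expR (omega q) = exp_w1c a b q.
  move=> Dq q0; have [fq gq] := frame_f_of F Dq; have [hf hg] := h q Dq.
  have fuq : fu q = b * cosh (a * q.1).
    apply: (frame_fu (F0 := fun q => b / a * sinh (a * q.1)) Dq (fun q Dq => (h q Dq).1)).
    apply: (is_derive_eq (derv_mul (derv_cst _ _ (b / a)) (derv_sinh (dau _ _)))).
    by rewrite dirE /=; field.
  have gvq : gv q = b * cos (a * q.2).
    apply: (frame_gv (F0 := fun q => b / a * sin (a * q.2)) Dq (fun q Dq => (h q Dq).2)).
    apply: (is_derive_eq (derv_mul (derv_cst _ _ (b / a)) (derv_sin (dav _ _)))).
    by rewrite dirE /=; field.
  have := frame_harm F Dq; rewrite -fq -gq hf hg fuq gvq /exp_w1c.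
  have ch : 1 < cosh (a * q.1) by rewrite cosh_gt1 // mulf_neq0.
  have cg : -1 <= cos (a * q.2) by exact: cos_geN1.
  have pos : b * (cosh (a * q.1) + cos (a * q.2)) != 0.
    by rewrite mulf_neq0 // gt_eqF //; lra.
  have e1 := cosh2_sinh2 (a * q.1); have e2 := cos2Dsin2 (a * q.2).
  rewrite mulrDr in pos *; move=> hh; apply: (mulIf pos); rewrite hh.
  apply: (@subr0P _ _ _ (- (b / a) ^+ 2 * ((cosh (a * q.1) ^+ 2 - sinh (a * q.1) ^+ 2 - 1) -
    (cos (a * q.2) ^+ 2 + sin (a * q.2) ^+ 2 - 1)))); first by field.
  by rewrite e1 e2 !subrr mulr0.
pose G q := expR (omega q) - exp_w1c a b q.
have dG : partials D G (fun=> 0) (fun=> 0).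
  move=> q Dq; have [du dv] := frame_dE F Dq; have [fq gq] := frame_f_of F Dq.
  have [hf hg] := h q Dq; rewrite -fq hf in du; rewrite -gq hg in dv.
  split.
    apply: (is_derive_eq (derv_add du (derv_opp (derv_mul (derv_cst _ _ (b / a ^+ 2))
      (derv_add (derv_cosh (dau _ _)) (derv_opp (derv_cos (dav _ _)))))))).
    by rewrite !dirE /=; field.
  apply: (is_derive_eq (derv_add dv (derv_opp (derv_mul (derv_cst _ _ (b / a ^+ 2))
    (derv_add (derv_cosh (dau _ _)) (derv_opp (derv_cos (dav _ _)))))))).
  by rewrite !dirE /=; field.
have nD : nbhs p D by apply: open_nbhs_nbhs; split; [exact: frame_open F|].
have [e e0 He] := nbhs_box nD.
have [q Dq q0] : exists2 q, D q & q.1 != 0.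
  have [p0|] := eqVneq p.1 0; last by exists p.
  exists (e / 2, p.2) => /=; last by rewrite gt_eqF // divr_gt0.
  apply: He; last by rewrite subrr normr0.
  by rewrite p0 subr0 gtr0_norm ?divr_gt0 //; lra.
have := partials0_const (frame_open F) (frame_connected F) dG Dq Dp.
by rewrite /G (off q Dq q0) subrr => /eqP; rewrite subr_eq0 => /eqP.
Qed.

(** In each case g is a function of v alone, possibly zero. *)
Lemma cases_mixed : case1 D omega \/ case2 D omega -> forall p, D p -> gu p = 0.
Proof.
move=> H p Dp.
have dbs b (q : R * R) := derv_mul (derv_cst q (eu R) b) (derv_snd q (eu R)).
move: H => [[_ [[a _ h]|[b _ h]|[a [b [_ _ h]]]]]|[k h]].
- exact: (frame_gu (F0 := fun=> 0) Dp (fun q Dq => (h q Dq).2) (derv_cst _ _ _)).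
- apply: (frame_gu (F0 := fun q => b * q.2) Dp (fun q Dq => (h q Dq).2)).
  by apply: (is_derive_eq (dbs b p)); rewrite dirE; ring.
- apply: (frame_gu (F0 := fun q => b / a * sin (a * q.2)) Dp (fun q Dq => (h q Dq).2)).
  apply: (is_derive_eq (derv_mul (derv_cst _ _ (b / a)) (derv_sin (dbs a p)))).
  by rewrite dirE; ring.
- apply: (frame_gu (F0 := fun=> 0) Dp _ (derv_cst _ _ _)) => q Dq.
  rewrite (frame_f_of F Dq).2.
  apply: (is_derive_open_eq (frame_open F) Dq _ (frame_dE F Dq).2 (derv_cst q _ (expR k))).
  by move=> x Dx; rewrite h.
Qed.

End ClosedForms.

Lemma eu_shift (u v t : R) : (u, v) + t *: eu R = (u + t, v).
Proof.
by congr pair; rewrite /= dirE ?scaler0 ?addr0 //; rewrite -[t *: 1]/(t * 1) mulr1.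
Qed.

Lemma ev_shift (u v t : R) : (u, v) + t *: ev R = (u, v + t).
Proof.
by congr pair; rewrite /= dirE ?scaler0 ?addr0 //; rewrite -[t *: 1]/(t * 1) mulr1.
Qed.

Lemma exp_w1b_eu (b : R) : 0 < b -> ~ periodic_along (eu R) (exp_w1b b).
Proof.
move=> b0 [T T0 /(_ (0, 0))]; rewrite eu_shift /exp_w1b /= => h.
have bT : 0 < b * T ^+ 2 by rewrite mulr_gt0 // exprn_gt0.
have h0 : b * T ^+ 2 = 0.
  apply: (mulIf (_ : 2^-1 != 0)); first by rewrite invr_eq0 pnatr_eq0.
  lincomb (b / 2 * ((0 + T) ^+ 2 + 0 ^+ 2) - b / 2 * (0 ^+ 2 + 0 ^+ 2)).
  by rewrite h subrr.
by rewrite h0 ltxx in bT.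
Qed.

Lemma exp_w1b_ev (b : R) : 0 < b -> ~ periodic_along (ev R) (exp_w1b b).
Proof.
move=> b0 [T T0 /(_ (0, 0))]; rewrite ev_shift /exp_w1b /= => h.
have bT : 0 < b * T ^+ 2 by rewrite mulr_gt0 // exprn_gt0.
have h0 : b * T ^+ 2 = 0.
  apply: (mulIf (_ : 2^-1 != 0)); first by rewrite invr_eq0 pnatr_eq0.
  lincomb (b / 2 * (0 ^+ 2 + (0 + T) ^+ 2) - b / 2 * (0 ^+ 2 + 0 ^+ 2)).
  by rewrite h subrr.
by rewrite h0 ltxx in bT.
Qed.

Lemma exp_w1c_eu (a b : R) : 0 < a -> 0 < b -> ~ periodic_along (eu R) (exp_w1c a b).
Proof.
move=> a0 b0 [T T0 /(_ (0, 0))]; rewrite eu_shift /exp_w1c /= add0r mulr0.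
have k0 : b / a ^+ 2 != 0 by rewrite gt_eqF // divr_gt0 // exprn_gt0.
move=> /(mulfI k0) /addIr h.
have : 1 < cosh (a * T) by rewrite cosh_gt1 // gt_eqF // mulr_gt0.
by rewrite h /cosh oppr0 expR0 divff // ltxx.
Qed.

Lemma exp_w1c_ev (a b : R) : 0 < a -> periodic_along (ev R) (exp_w1c a b).
Proof.
move=> a0; exists (2 * pi / a); first by rewrite divr_gt0 // mulr_gt0 // pi_gt0.
move=> [u v]; rewrite ev_shift /exp_w1c /=.
have -> : a * (v + 2 * pi / a) = a * v + pi *+ 2.
  by rewrite mulr2n; field; rewrite gt_eqF.
by rewrite cosD2pi.
Qed.

End ClosedFormsOfCases.

(** * Null rotations and the surfaces of case (1a) *)

Section Revolution.
Variable R : realType.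

(* Y |-> Y + <Y, q> pp - <Y, pp> q - <q, q> <Y, pp> pp / 2 with q = (0, a, b, 0). *)
Definition null_rotation (a b : R) : 'M[R]_4 :=
  let s := (a ^+ 2 + b ^+ 2) / 2 in
  \matrix_(i, j) (nth [::] [:: [:: 1 + s; a; b; - s]; [:: a; 1; 0; - a];
    [:: b; 0; 1; - b]; [:: s; a; b; 1 - s]] i)`_j.

Lemma null_rotationE a b (Y : 'cV[R]_4) : let s := (a ^+ 2 + b ^+ 2) / 2 in
  let m := Y 3%:R 0 - Y 0 0 in
  [/\ (null_rotation a b *m Y) 0 0 = Y 0 0 + a * Y 1 0 + b * Y 2%:R 0 - s * m,
      (null_rotation a b *m Y) 1 0 = Y 1 0 - a * m,
      (null_rotation a b *m Y) 2%:R 0 = Y 2%:R 0 - b * m &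
      (null_rotation a b *m Y) 3%:R 0 = Y 3%:R 0 + a * Y 1 0 + b * Y 2%:R 0 - s * m].
Proof.
have e1 : lift ord0 ord0 = 1 :> 'I_4 by exact/val_inj.
have e2 : lift ord0 (lift ord0 ord0) = 2%:R :> 'I_4 by exact/val_inj.
have e3 : lift ord0 (lift ord0 (lift ord0 ord0)) = 3%:R :> 'I_4 by exact/val_inj.
by split; rewrite !mxE !big_ord_recl big_ord0 !mxE ?e1 ?e2 ?e3 /=; ring.
Qed.

(* In the basis pp, e_1, e_2, e_3 a null rotation is unitriangular. *)
Lemma det_null_rotation a b : \det (null_rotation a b) = 1.
Proof.
pose P : 'M[R]_4 := \matrix_(i, j) (nth [::] [:: [:: 1; 0; 0; 0]; [:: 0; 1; 0; 0];
  [:: 0; 0; 1; 0]; [:: 1; 0; 0; 1]] i)`_j.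
pose U : 'M[R]_4 := \matrix_(i, j) (nth [::] [:: [:: 1; 0; 0; 0]; [:: a; 1; 0; 0];
  [:: b; 0; 1; 0]; [:: - ((a ^+ 2 + b ^+ 2) / 2); - a; - b; 1]] i)`_j.
have unit (A : 'M[R]_4) : is_trig_mx A -> (forall i, A i i = 1) -> \det A = 1.
  by move=> trA A1; rewrite det_trig // big1.
have dP : \det P = 1.
  apply: unit => [|i]; last by rewrite mxE; case: i => -[|[|[|[|]]]].
  by apply/is_trig_mxP => -[[|[|[|[|]]]] Hi] // [[|[|[|[|]]]] Hj] //; rewrite mxE.
have dU : \det U = 1.
  apply: unit => [|i]; last by rewrite mxE; case: i => -[|[|[|[|]]]].
  by apply/is_trig_mxP => -[[|[|[|[|]]]] Hi] // [[|[|[|[|]]]] Hj] //; rewrite mxE.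
have MP : null_rotation a b *m P = P *m U^T.
  apply/matrixP => i j; rewrite !mxE !big_ord_recl !big_ord0 !mxE.
  by case: i => -[|[|[|[|//]]]] Hi; case: j => -[|[|[|[|//]]]] Hj /=; ring.
by have := congr1 determinant MP; rewrite !det_mulmx det_tr dP dU !mulr1.
Qed.

Lemma half_lt (e : R) : 0 < e -> e / 2 < e.
Proof. by move=> e0; lra. Qed.

Lemma null_rotation_isometry a b (t : 'cV[R]_4) : I3 t ->
  isometry_I3 (fun Y => null_rotation a b *m Y + t).
Proof.
move=> It; exists (null_rotation a b), t; split=> //.
- split; last exact: det_null_rotation.
  move=> Y Z; rewrite !mink4.
  have [-> -> -> ->] := null_rotationE a b Y.
  have [-> -> -> ->] := null_rotationE a b Z.
  by field.
- have [p0 p1 p2 p3] := @ppE R.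
  apply/colP => i; have [] := null_rotationE a b (pp R).
  rewrite p0 p1 p2 p3 subrr !mulr0 !addr0 !subr0 => h0 h1 h2 h3.
  by elim/ord4P: i; rewrite ?h0 ?h1 ?h2 ?h3 ?p0 ?p1 ?p2 ?p3.
Qed.

(** In the plane, b is a quarter turn of a up to the orientation sign s = det(a, b) / e^2. This sign
    decides in which sense the surface of case (1a) turns with v. *)
Lemma frame_turn (a1 a2 b1 b2 e : R) : e != 0 ->
  a1 ^+ 2 + a2 ^+ 2 = e ^+ 2 -> b1 ^+ 2 + b2 ^+ 2 = e ^+ 2 ->
  a1 * b1 + a2 * b2 = 0 ->
  exists s : R, [/\ s = 1 \/ s = -1, b1 = - (s * a2) & b2 = s * a1].
Proof.
move=> e0 ha hb hab.
have [h1 h2 h12] := frame_dual e0 ha hb hab.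
have e2 : e ^+ 2 != 0 by rewrite expf_neq0.
pose s := (a1 * b2 - a2 * b1) / e ^+ 2.
have E1 : b1 = - (s * a2).
  apply: (mulfI e2); rewrite /s.
  have -> : e ^+ 2 * - ((a1 * b2 - a2 * b1) / e ^+ 2 * a2) = - ((a1 * b2 - a2 * b1) * a2).
    by field.
  lincomb ((e ^+ 2 - (a2 ^+ 2 + b2 ^+ 2)) * b1 + b2 * (a1 * a2 + b1 * b2)).
  by rewrite h2 h12; ring.
have E2 : b2 = s * a1.
  apply: (mulfI e2); rewrite /s.
  have -> : e ^+ 2 * ((a1 * b2 - a2 * b1) / e ^+ 2 * a1) = (a1 * b2 - a2 * b1) * a1.
    by field.
  lincomb ((e ^+ 2 - (a1 ^+ 2 + b1 ^+ 2)) * b2 + b1 * (a1 * a2 + b1 * b2)).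
  by rewrite h1 h12; ring.
exists s; split=> //.
have : (s - 1) * (s + 1) = 0.
  apply: (mulfI e2); rewrite mulr0.
  have hs : s ^+ 2 * (a1 ^+ 2 + a2 ^+ 2) = e ^+ 2.
    by rewrite -[RHS]hb E1 E2; ring.
  by rewrite ha in hs; rewrite -[RHS](subrr (e ^+ 2)) -{2}hs; ring.
move/eqP; rewrite mulf_eq0 subr_eq0 addr_eq0 => /orP[] /eqP; by [left|right].
Qed.

Lemma revolution_1a D c (X Xu Xv : R * R -> 'cV[R]_4)
    (omega f g fu fv gu gv : R * R -> R) p0 a :
  frame D c X Xu Xv (fun p => expR (omega p)) f g fu fv gu gv -> D p0 ->
  0 < a -> case1a D omega a -> surface_of_revolution D X.
Proof.
move=> F Dp0 a0 h.
have an : a != 0 by rewrite gt_eqF.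
have EE := closed_form_1a F a0 h.
have [oD cD c1 E0 dE _ _ _ _ X3 uu vv uv dX dXu dXv] := F.
have [pp0 pp1 pp2 pp3] := @ppE R.
have fg p : D p -> f p / expR (omega p) = - a /\ g p = 0.
  move=> Dp; have [<- <-] := frame_f_of F Dp; have [-> ->] := h p Dp.
  rewrite EE // /exp_w1a; split=> //.
  by field; rewrite an gt_eqF // expR_gt0.
(* With f / E = - a and g = 0, the shift by c p / a makes the frame equations homogeneous: Y_u = - a
   Y, Y_v = - a X_v and X_vv = a Y. *)
pose Y i p := Xu p i 0 + c * pp R i 0 / a.
have dY i : partials D (Y i) (fun p => - a * Y i p) (fun p => - a * Xv p i 0).
  move=> p Dp; have [d1 d2] := dXu i p Dp; have [hf hg] := fg p Dp; split.
    apply: (is_derive_eq (derv_add d1 (derv_cst _ _ _))).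
    rewrite hg mul0r subr0 mulrAC hf /Y; field; exact: an.
  apply: (is_derive_eq (derv_add d2 (derv_cst _ _ _))).
  by rewrite hg mul0r add0r addr0 mulrAC hf.
have dV i : partials D (fun p => Xv p i 0) (fun p => - a * Xv p i 0) (fun p => a * Y i p).
  move=> p Dp; have [d1 d2] := dXv i p Dp; have [hf hg] := fg p Dp; split.
    by apply: (is_derive_eq d1); rewrite hg mul0r add0r mulrAC hf.
  apply: (is_derive_eq d2); rewrite hg mul0r add0r mulNr mulrAC hf /Y; field; exact: an.
have dau q v := derv_mul (derv_cst q v a) (derv_fst q v).
have dav q v := derv_mul (derv_cst q v a) (derv_snd q v).
(* [A] and [B] undo the decay in u and the turning in v of the pair (Y, X_v); [C] is what remains of
   X after integrating X_u = Y - c p / a. *)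
pose A i (p : R * R) := expR (a * p.1) * (cos (a * p.2) * Y i p + sin (a * p.2) * Xv p i 0).
pose B i (p : R * R) := expR (a * p.1) * (cos (a * p.2) * Xv p i 0 - sin (a * p.2) * Y i p).
pose C i p := X p i 0 + Y i p / a + c * p.1 * pp R i 0 / a.
have Ac i p : D p -> A i p = A i p0.
  move=> Dp; apply: (partials0_const oD cD _ Dp0 Dp) => {Dp}p Dp.
  have [d1 d2] := dY i p Dp; have [e1 e2] := dV i p Dp; split.
    apply: (is_derive_eq (derv_mul (derv_exp (dau p (eu R))) (derv_add
      (derv_mul (derv_cos (dav p (eu R))) d1) (derv_mul (derv_sin (dav p (eu R))) e1)))).
    by rewrite !dirE /=; ring.
  apply: (is_derive_eq (derv_mul (derv_exp (dau p (ev R))) (derv_add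
      (derv_mul (derv_cos (dav p (ev R))) d2) (derv_mul (derv_sin (dav p (ev R))) e2)))).
  by rewrite !dirE /=; ring.
have Bc i p : D p -> B i p = B i p0.
  move=> Dp; apply: (partials0_const oD cD _ Dp0 Dp) => {Dp}p Dp.
  have [d1 d2] := dY i p Dp; have [e1 e2] := dV i p Dp; split.
    apply: (is_derive_eq (derv_mul (derv_exp (dau p (eu R))) (derv_add
      (derv_mul (derv_cos (dav p (eu R))) e1)
      (derv_opp (derv_mul (derv_sin (dav p (eu R))) d1))))).
    by rewrite !dirE /=; ring.
  apply: (is_derive_eq (derv_mul (derv_exp (dau p (ev R))) (derv_add
      (derv_mul (derv_cos (dav p (ev R))) e2)
      (derv_opp (derv_mul (derv_sin (dav p (ev R))) d2))))).
  by rewrite !dirE /=; ring.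
have Cc i p : D p -> C i p = C i p0.
  move=> Dp; apply: (partials0_const oD cD _ Dp0 Dp) => {Dp}p Dp.
  have [d1 d2] := dY i p Dp; have [e1 e2] := dX i p Dp.
  have dc v := derv_mul (derv_mul (derv_mul (derv_cst p v c) (derv_fst p v))
    (derv_cst p v (pp R i 0))) (derv_cst p v a^-1).
  split.
    apply: (is_derive_eq (derv_add (derv_add e1 (derv_mul d1 (derv_cst _ _ a^-1))) (dc _))).
    by rewrite !dirE /Y /=; field.
  apply: (is_derive_eq (derv_add (derv_add e2 (derv_mul d2 (derv_cst _ _ a^-1))) (dc _))).
  by rewrite !dirE /=; field.
have cs (x : R) := cos2Dsin2 x.
have ee (x : R) : expR (- x) * expR x = 1 by rewrite -expRD addNr expR0.
have YE i p : D p -> Y i p =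
    expR (- (a * p.1)) * (cos (a * p.2) * A i p0 - sin (a * p.2) * B i p0).
  move=> Dp; rewrite -(Ac i p Dp) -(Bc i p Dp) /A /B.
  transitivity ((expR (- (a * p.1)) * expR (a * p.1)) *
    (cos (a * p.2) ^+ 2 + sin (a * p.2) ^+ 2) * Y i p); last by ring.
  by rewrite ee cs !mul1r.
have ex0 : expR (a * p0.1) * expR (omega p0) = a^-1.
  by rewrite EE // /exp_w1a mulrCA [_ * expR (- _)]mulrC ee mulr1.
have Y12 : Y 1 p0 = Xu p0 1 0 /\ Y 2%:R p0 = Xu p0 2%:R 0.
  by rewrite /Y pp1 pp2 !mulr0 !mul0r !addr0.
have [uu0 vv0 uv0] := And3 (uu _ Dp0) (vv _ Dp0) (uv _ Dp0).
have ian : a^-1 != 0 by rewrite invr_eq0.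
have [y1 y2] := Y12.
have hA : A 1 p0 ^+ 2 + A 2%:R p0 ^+ 2 = a^-1 ^+ 2.
  rewrite -ex0 /A y1 y2.
  transitivity (expR (a * p0.1) ^+ 2 * (cos (a * p0.2) ^+ 2 *
      (Xu p0 1 0 ^+ 2 + Xu p0 2%:R 0 ^+ 2) + sin (a * p0.2) ^+ 2 *
      (Xv p0 1 0 ^+ 2 + Xv p0 2%:R 0 ^+ 2) + 2 * cos (a * p0.2) * sin (a * p0.2) *
      (Xu p0 1 0 * Xv p0 1 0 + Xu p0 2%:R 0 * Xv p0 2%:R 0))); first by ring.
  by rewrite uu0 vv0 uv0 mulr0 addr0 -mulrDl cs mul1r exprMn.
have [s [s1 B1 B2]] : exists s : R, [/\ s = 1 \/ s = -1,
    B 1 p0 = - (s * A 2%:R p0) & B 2%:R p0 = s * A 1 p0].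
  apply: (frame_turn ian) => //; rewrite -?ex0 /A /B y1 y2.
  - transitivity (expR (a * p0.1) ^+ 2 * (sin (a * p0.2) ^+ 2 *
      (Xu p0 1 0 ^+ 2 + Xu p0 2%:R 0 ^+ 2) + cos (a * p0.2) ^+ 2 *
      (Xv p0 1 0 ^+ 2 + Xv p0 2%:R 0 ^+ 2) - 2 * cos (a * p0.2) * sin (a * p0.2) *
      (Xu p0 1 0 * Xv p0 1 0 + Xu p0 2%:R 0 * Xv p0 2%:R 0))); first by ring.
    rewrite uu0 vv0 uv0 mulr0 subr0 -mulrDl [sin _ ^+ 2 + _]addrC cs mul1r.
    by rewrite exprMn.
  - transitivity (expR (a * p0.1) ^+ 2 * ((cos (a * p0.2) ^+ 2 - sin (a * p0.2) ^+ 2) *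
      (Xu p0 1 0 * Xv p0 1 0 + Xu p0 2%:R 0 * Xv p0 2%:R 0) +
      cos (a * p0.2) * sin (a * p0.2) * ((Xv p0 1 0 ^+ 2 + Xv p0 2%:R 0 ^+ 2) -
      (Xu p0 1 0 ^+ 2 + Xu p0 2%:R 0 ^+ 2)))); first by ring.
    by rewrite uu0 vv0 uv0 subrr !mulr0 addr0 mulr0.
have ss : s * s = 1 by case: s1 => ->; rewrite ?mulrNN mulr1.
(* The null rotation must kill the l-components of A and B, two linear equations for [al] and [be].
   The horizontal parts of A and B are orthogonal of length 1 / a, so the inverse matrix is a^2
   times the transpose. *)
pose al := - (A 0 p0 * A 1 p0 - s * B 0 p0 * A 2%:R p0) * a ^+ 2.
pose be := - (A 0 p0 * A 2%:R p0 + s * B 0 p0 * A 1 p0) * a ^+ 2.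
have ha : a ^+ 2 * (A 1 p0 ^+ 2 + A 2%:R p0 ^+ 2) = 1.
  by rewrite hA -exprMn divff // expr1n.
have kA : A 0 p0 + al * A 1 p0 + be * A 2%:R p0 = 0.
  transitivity (A 0 p0 * (1 - a ^+ 2 * (A 1 p0 ^+ 2 + A 2%:R p0 ^+ 2))).
    by rewrite /al /be; ring.
  by rewrite ha subrr mulr0.
have kB : B 0 p0 + al * B 1 p0 + be * B 2%:R p0 = 0.
  transitivity (B 0 p0 * (1 - (s * s) * (a ^+ 2 * (A 1 p0 ^+ 2 + A 2%:R p0 ^+ 2)))).
    by rewrite B1 B2 /al /be; ring.
  by rewrite ha ss mulr1 subrr mulr0.
pose C0 : 'cV[R]_4 := \col_i C i p0.
have C0E i : C0 i 0 = C i p0 by rewrite mxE.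
have [xu3 xv3] := frame_tangent_I3 F Dp0.
have C3 : C 3%:R p0 = C 0 p0 by rewrite /C /Y xu3 X3 // pp0 pp3.
pose M := null_rotation al be.
pose T Y := M *m Y + - (M *m C0).
have neg (V : 'cV[R]_4) i : (- V) i 0 = - V i 0 by rewrite mxE.
have [m0 m1 m2 m3] := null_rotationE al be C0.
rewrite !C0E C3 in m0 m1 m2 m3.
exists T.
  apply: null_rotation_isometry; apply/I3P.
  by rewrite !neg m0 m3.
have TE i p : T (X p) i 0 = (M *m X p) i 0 - (M *m C0) i 0 by rewrite /T mxE neg.
have XE i p : D p -> X p i 0 = C i p0 - Y i p / a - c * p.1 * pp R i 0 / a.
  by move=> Dp; rewrite -(Cc i p Dp) /C; ring.
have TX p : D p -> [/\ T (X p) 0 0 = - (c * p.1 / a),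
    T (X p) 1 0 = - (expR (- (a * p.1)) / a) *
      (cos (a * p.2) * A 1 p0 + s * sin (a * p.2) * A 2%:R p0),
    T (X p) 2%:R 0 = - (expR (- (a * p.1)) / a) *
      (cos (a * p.2) * A 2%:R p0 - s * sin (a * p.2) * A 1 p0) &
    T (X p) 3%:R 0 = - (c * p.1 / a)].
  move=> Dp; have [x0 x1 x2 x3] := null_rotationE al be (X p).
  have l0 : T (X p) 0 0 = - (c * p.1 / a).
    rewrite TE x0 m0 X3 // !XE // pp0 pp1 pp2 !YE //.
    transitivity (- (c * p.1 / a) - expR (- (a * p.1)) / a *
      (cos (a * p.2) * (A 0 p0 + al * A 1 p0 + be * A 2%:R p0) -
       sin (a * p.2) * (B 0 p0 + al * B 1 p0 + be * B 2%:R p0))); first by field.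
    by rewrite kA kB; ring.
  split=> //.
  - by rewrite TE x1 m1 X3 // XE // pp1 YE // B1; field.
  - by rewrite TE x2 m2 X3 // XE // pp2 YE // B2; field.
  - by rewrite -[RHS]l0 !TE x0 x3 m0 m3 X3.
move=> p U Dp nU.
have nDU : nbhs p (U `&` D) by apply: filterI => //; exact: open_nbhs_nbhs.
have [e e0 He] := nbhs_box nDU.
have e2 : 0 < e / 2 by rewrite divr_gt0.
have ae2 : 0 < a * (e / 2) by rewrite mulr_gt0.
exists (ball p (e / 2), ball (0 : R) (a * (e / 2))).
  by split; exact: nbhsx_ballx.
move=> [[u v] t] [/= [/= hu hv] ht].
rewrite /ball /= distrC in hu; rewrite /ball /= distrC in hv.
rewrite /ball /= sub0r normrN in ht.
(* By [TX] the horizontal part turns by - s a v, so rotation by t amounts to shifting v by - s t /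
   a. The bound on t keeps this shift within half the box. *)
have sh : `|s * t / a| < e / 2.
  have sn : `|s| = 1 by case: s1 => ->; rewrite ?normrN normr1.
  by rewrite !normrM sn mul1r normfV (gtr0_norm a0) ltr_pdivrMr // [_ * a]mulrC.
have Du : D (u, v).
  exact: (He _ _ (lt_trans hu (half_lt e0)) (lt_trans hv (half_lt e0))).2.
have Uq : (U `&` D) (u, v - s * t / a).
  apply: He; first exact: lt_trans hu (half_lt e0).
  have -> : v - s * t / a - p.2 = (v - p.2) + - (s * t / a) by ring.
  by rewrite (le_lt_trans (ler_normD _ _)) // normrN [ltRHS]splitr ltrD.
exists (u, v - s * t / a) => //.
have [t0 t1 t2 t3] := TX _ Du; have [r0 r1 r2 r3] := TX _ Uq.2.
have rot : a * (v - s * t / a) = a * v - s * t by field.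
have st : cos (s * t) = cos t /\ sin (s * t) = s * sin t.
  by case: s1 => ->; rewrite ?mul1r ?mulN1r ?cosN ?sinN.
have csE : cos (a * v - s * t) = cos (a * v) * cos t + s * (sin (a * v) * sin t).
  by rewrite cosB st.1 st.2; ring.
have snE : s * sin (a * v - s * t) = s * (sin (a * v) * cos t) - cos (a * v) * sin t.
  rewrite sinB st.1 st.2; transitivity (s * (sin (a * v) * cos t) -
    s * s * (cos (a * v) * sin t)); first by ring.
  by rewrite ss mul1r.
rewrite /rotation t0 t1 t2 /= /vec4; apply/colP => i; rewrite mxE.
elim/ord4P: i => /=.
- by rewrite r0.
- rewrite r1 /= rot csE snE; ring.
- rewrite r2 /= rot csE snE; ring.
- by rewrite r3.
Qed.

End Revolution.

Section RevolutionTransport.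
Variable R : realType.

Lemma revolution_homeo D (X : R * R -> 'cV[R]_4) (phi psi : R * R -> R * R) :
  cancel psi phi -> continuous phi -> continuous psi ->
  surface_of_revolution (phi @^-1` D) (X \o phi) -> surface_of_revolution D X.
Proof.
move=> psiK cphi cpsi [T iT inv]; exists T => // p U Dp nU.
have nU' : nbhs (psi p) (phi @^-1` U) by apply: (cphi (psi p)); rewrite psiK.
have Dp' : (phi @^-1` D) (psi p) by rewrite /preimage /= psiK.
have [[A B] [/= nA nB] AB] := inv _ _ Dp' nU'.
exists (psi @^-1` A, B); first by split=> //; exact: cpsi.
move=> [q t] [/= Aq Bt]; have [q' [Uq' Dq'] /= rot] := AB (psi q, t) (conj Aq Bt).
by exists (phi q') => //=; rewrite -rot psiK.
Qed.

End RevolutionTransport.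

Theorem theorem3p5 (R : realType) (Sigma : set (R * R))
    (X n : R * R -> 'cV[R]_4) (omega : R * R -> R)
    (hS : simply_connected_domain Sigma)
    (hX : spacelike_immersion Sigma X)
    (hw : conformal_factor Sigma X omega)
    (hn : lightlike_gauss_map Sigma X n)
    (hnonplanar : ~ planar_surface Sigma X)
    (hH : forall p, Sigma p -> mean_curvature X n omega p = 0)
    (hQ : forall p, Sigma p -> hopf X n p = - 2^-1) :
  (planar_curvature_lines Sigma X <->
     exists phi : R * R -> R * R,
       coord_change phi /\
       (case1 (phi @^-1` Sigma) (omega \o phi) \/ case2 (phi @^-1` Sigma) (omega \o phi))) /\
  (forall phi : R * R -> R * R, coord_change phi ->
    [/\ forall a : R, 0 < a -> case1a (phi @^-1` Sigma) (omega \o phi) a ->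
          (forall p, (phi @^-1` Sigma) p -> expR ((omega \o phi) p) = exp_w1a a p) /\
          surface_of_revolution Sigma X,
        forall b : R, 0 < b -> case1b (phi @^-1` Sigma) (omega \o phi) b ->
          [/\ forall p, (phi @^-1` Sigma) p -> expR ((omega \o phi) p) = exp_w1b b p,
              ~ periodic_along (eu R) (exp_w1b b) &
              ~ periodic_along (ev R) (exp_w1b b)] &
        forall a b : R, 0 < a -> 0 < b ->
          case1c (phi @^-1` Sigma) (omega \o phi) a b ->
          [/\ forall p, (phi @^-1` Sigma) p -> expR ((omega \o phi) p) = exp_w1c a b p,
              ~ periodic_along (eu R) (exp_w1c a b) &
              periodic_along (ev R) (exp_w1c a b)]]).
Proof.
have [[p0 Sp0] oS cS _] := hS.
have [Xu [Xv [f [g [fu [fv [gu [gv F]]]]]]]] :=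
  frame_of_surface oS cS hX hw hn hH hQ.
(* The zero set of E_uv travels with the frame, so a case stated in new coordinates yields g_u = 0
   in the old ones. *)
have framedZ : framed Sigma X (fun p => expR (omega p)) [set p | gu p = 0].
  by do 9 eexists; split; first exact: F.
have framed_phi phi : coord_change phi -> exists c Xu Xv f g fu fv gu' gv,
    frame (phi @^-1` Sigma) c (X \o phi) Xu Xv (fun p => expR ((omega \o phi) p))
      f g fu fv gu' gv /\ forall p, Sigma (phi p) -> (gu' p = 0 <-> gu (phi p) = 0).
  by move=> cphi; exact: (framed_coord_change cphi framedZ).
split.
  apply: (iff_trans (planar_iff F)); split=> [gu0|[phi [cphi cases]] p Sp].
    apply: (separated_classified (f := f) (g := g) (fu := fu) (gv := gv) Sp0).
    split=> //.
    - by move=> p _; exact: expR_gt0.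
    - exact: frame_dE F.
    - move=> p Sp; have [d1 d2] := frame_df F Sp; split; first exact: d1.
      by rewrite (frame_sym F Sp) gu0 in d2.
    - move=> p Sp; have [d1 d2] := frame_dg F Sp; split; last exact: d2.
      by rewrite gu0 in d1.
    - exact: frame_harm F.
  have [psi [_ psiK _ _]] := coord_change_homeo cphi.
  have [c [Xu' [Xv' [f' [g' [fu' [fv' [gu' [gv' [F' Z]]]]]]]]]] := framed_phi _ cphi.
  have Sp' : Sigma (phi (psi p)) by rewrite psiK.
  by rewrite -[p]psiK; apply: (Z _ Sp').1; exact: (cases_mixed F' cases).
move=> phi cphi; have [psi [phiK psiK cc cpsi]] := coord_change_homeo cphi.
have [c [Xu' [Xv' [f' [g' [fu' [fv' [gu' [gv' [F' _]]]]]]]]]] := framed_phi _ cphi.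
split.
- move=> a a0 h; split; first exact: (closed_form_1a F' a0 h).
  apply: (revolution_homeo psiK cc cpsi).
  by apply: (revolution_1a (p0 := psi p0) F' _ a0 h); rewrite /preimage /= psiK.
- move=> b b0 h; split; first exact: (closed_form_1b F' b0 h).
    exact: exp_w1b_eu.
  exact: exp_w1b_ev.
- move=> a b a0 b0 h; split; first exact: (closed_form_1c F' a0 b0 h).
    exact: exp_w1c_eu.
  exact: exp_w1c_ev.
Qed.
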